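(* Let $G_m$ be a bounded Vilenkin group and let $0<p<1/2$. Then there exists an absolute constant $c_p$, depending only on $p$, such that for every $f\in H_p(G_m)$ the inequality $$\sum_{n=1}^{\infty}\frac{\log^p n\,\left\Vert R^{\psi}_n f\right\Vert_{H_p(G_m)}^p}{n^{2-2p}}\leq c_p\left\Vert f\right\Vert_{H_p(G_m)}^p$$ holds, where $R^{\psi}_n f$ denotes the $n$-th Riesz logarithmic mean of the Vilenkin-Fourier series of $f$.
   Context: Let $\mathbb{N}=\{0,1,2,\dots\}$ and $\mathbb{N}_+=\{1,2,\dots\}$. Let $m=(m_0,m_1,\dots)$ be a fixed sequence of integers with $m_k\ge 2$ and $\sup_k m_k<\infty$ (bounded case). Let $Z_{m_k}=\{0,1,\dots,m_k-1\}$ be the additive group of integers modulo $m_k$, and let $G_m=\prod_{k=0}^\infty Z_{m_k}$ be the complete direct product with the product of the discrete topologies; $G_m$ is called a bounded Vilenkin group. Let $\mu$ be its Haar measure with $\mu(G_m)=1$, i.e. the product of the uniform probability measures on the $Z_{m_k}$. The group $G_m$ is fixed throughout (the constant in the claim does not depend on $f$). Elements are written $x=(x_0,x_1,\dots)$, $x_k\in Z_{m_k}$. Put $I_0(x)=G_m$ and $I_n(x)=\{y\in G_m: y_0=x_0,\dots,y_{n-1}=x_{n-1}\}$ for $n\ge1$. Put $M_0=1$, $M_{k+1}=m_kM_k$. Every $n\in\mathbb{N}$ is uniquely $n=\sum_{k=0}^\infty n_kM_k$ with $n_k\in Z_{m_k}$ and only finitely many $n_k$ nonzero. The generalized Rademacher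 functions are $r_k(x)=\exp(2\pi i x_k/m_k)$ and the Vilenkin system is $\psi_n(x)=\prod_{k=0}^\infty r_k^{n_k}(x)$, $n\in\mathbb{N}$. Let $\digamma_n$ be the $\sigma$-algebra generated by the sets $I_n(x)$, $x\in G_m$. A martingale $f=(f^{(n)},n\in\mathbb{N})$ is a martingale with respect to $(\digamma_n)_{n\in\mathbb{N}}$ and $\mu$. Its maximal function is $f^*=\sup_{n\in\mathbb{N}}|f^{(n)}|$. With $\|g\|_p=\left(\int_{G_m}|g|^p\,d\mu\right)^{1/p}$, for $0<p<\infty$ the martingale Hardy space $H_p(G_m)$ consists of all martingales $f$ with $\|f\|_{H_p(G_m)}:=\|f^*\|_p<\infty$. A function $g\in L_1(G_m)$ is identified with the martingale $(S_{M_n}^\psi g)_{n\in\mathbb{N}}$, whose maximal function is $g^*(x)=\sup_{n\in\mathbb{N}}\frac{1}{\mu(I_n(x))}\left|\int_{I_n(x)}g\,d\mu\right|$, and $\|g\|_{H_p(G_m)}=\|g^*\|_p$. The Vilenkin-Fourier coefficients of a martingale $f$ are $\widehat f(i)=\lim_{k\to\infty}\int_{G_m}f^{(k)}\overline{\psi_i}\,d\mu$ (for $f\in L_1(G_m)$ these are the usual coefficients $\int_{G_m} f\overline{\psi_i}\,d\mu$). The partial sums are $S^\psi_nf=\sum_{k=0}^{n-1}\widehat f(k)\psi_k$ for $n\in\mathbb{N}_+$. The $n$-th Riesz logarithmic mean is $$R^\psi_nf=\frac1{l_n}\sum_{k=1}^n\frac{S^\psi_kf}{k},\qquad l_n=\sum_{k=1}^n\frac1k,\qquad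 n\in\mathbb{N}_+.$$ Here $\log^p n$ means $(\log n)^p$. *)

(* Defs.v *)
From HB Require Import structures.
From mathcomp Require Import all_boot all_order all_algebra.
From mathcomp Require Import complex.
From mathcomp Require Import all_classical all_reals all_analysis.
From mathcomp Require Import zify ring.

Set Implicit Arguments.
Unset Strict Implicit.
Unset Printing Implicit Defensive.

Import Order.TTheory GRing.Theory Num.Theory.
Import numFieldNormedType.Exports.
Import ComplexField.

Local Open Scope classical_set_scope.
Local Open Scope ring_scope.
Local Open Scope complex_scope.

(* The group G_m.  'Z_n is the integers modulo n only for n >= 2, so m k >= 2
   has to be assumed wherever vilenkin m is meant to be G_m. *)
Definition vilenkin (m : nat -> nat) : Type := forall k : nat, 'Z_(m k).

Section Group.
Variable m : nat -> nat.
Implicit Types x y z : vilenkin m.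

HB.instance Definition _ :=
  Choice.copy (vilenkin m) (forall k : nat, 'Z_(m k))%type.

Let vadd x y : vilenkin m := fun k => x k + y k.
Let vopp x : vilenkin m := fun k => - x k.
Let vzero : vilenkin m := fun=> 0.

Let vaddA : associative vadd.
Proof. by move=> x y z; apply: functional_extensionality_dep => k; exact: addrA. Qed.
Let vaddC : commutative vadd.
Proof. by move=> x y; apply: functional_extensionality_dep => k; exact: addrC. Qed.
Let vadd0 : left_id vzero vadd.
Proof. by move=> x; apply: functional_extensionality_dep => k; exact: add0r. Qed.
Let vaddN : left_inverse vzero vopp vadd.
Proof. by move=> x; apply: functional_extensionality_dep => k; exact: addNr. Qed.

HB.instance Definition _ :=
  GRing.isZmodule.Build (vilenkin m) vaddA vaddC vadd0 vaddN.
HB.instance Definition _ := isPointed.Build (vilenkin m) 0.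

Definition cylinder (n : nat) (x : vilenkin m) : set (vilenkin m) :=
  [set y | forall k, (k < n)%N -> y k = x k].

Definition level_cylinders (n : nat) : set (set (vilenkin m)) :=
  [set cylinder n x | x in setT].

(* The measurable sets of G_m: the cylinders form a countable base of the
   product of the discrete topologies, so this is the Borel sigma-algebra. *)
Definition cylinders : set (set (vilenkin m)) := \bigcup_n level_cylinders n.

HB.instance Definition _ :=
  Measurable.copy (vilenkin m) (g_sigma_algebraType cylinders).

Fixpoint gen_num (k : nat) : nat :=
  if k is k'.+1 then (m k' * gen_num k')%N else 1%N.

(* n_k in the expansion n = \sum_k n_k M_k *)
Definition digit (n k : nat) : nat := ((n %/ gen_num k) %% m k)%N.

End Group.

Arguments level_cylinders : clear implicits.
Arguments cylinders : clear implicits.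

Section Analysis.
Variables (R : realType) (m : nat -> nat).
Local Notation C := R[i].
Local Notation G := (vilenkin m).

Definition expi (t : R) : C := cos t +i* sin t.

Definition rademacher (k : nat) (x : G) : C :=
  expi (2 * pi * (x k : nat)%:R / (m k)%:R).

(* n_k = 0 for k >= n because M_k >= 2 ^ k, so the infinite product stops
   before k = n. *)
Definition psi (n : nat) (x : G) : C :=
  \prod_(k < n) rademacher k x ^+ digit m n k.

(* [mu] is normalized by its type *)
Definition haar (mu : probability G R) : Prop :=
  forall (a : G) (A : set G), measurable A ->
    mu ((fun x => a + x) @^-1` A) = mu A.

Variable mu : probability G R.

Definition cintegral (D : set G) (g : G -> C) : C :=
  (\int[mu]_(x in D) complex.Re (g x)) +i* (\int[mu]_(x in D) complex.Im (g x)).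

Definition cintegrable (g : G -> C) : Prop :=
  mu.-integrable setT (fun x => (complex.Re (g x))%:E) /\
  mu.-integrable setT (fun x => (complex.Im (g x))%:E).

Definition level_measurable (n : nat) (g : G -> C) : Prop :=
  let Gn := g_sigma_algebraType (level_cylinders m n) in
  measurable_fun (setT : set Gn) (fun x : Gn => complex.Re (g x)) /\
  measurable_fun (setT : set Gn) (fun x : Gn => complex.Im (g x)).

Record martingale (f : nat -> G -> C) : Prop := Martingale {
  mart_adapted : forall n, level_measurable n (f n) ;
  mart_integrable : forall n, cintegrable (f n) ;
  mart_cond : forall n (A : set G), <<s level_cylinders m n >> A ->
    cintegral A (f n.+1) = cintegral A (f n) }.

Definition maximal (f : nat -> G -> C) (x : G) : \bar R :=
  ereal_sup (range (fun n => (Normc.normc (f n x))%:E)).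

Definition hardy_norm (p : R) (f : nat -> G -> C) : \bar R :=
  ('N[mu]_(p%:E)[maximal f])%E.

Definition hardy (p : R) (f : nat -> G -> C) : Prop :=
  martingale f /\ (hardy_norm p f < +oo)%E.

Definition fcoef (g : G -> C) (i : nat) : C :=
  cintegral setT (fun x => g x * (psi i x)^*).

Definition mart_fcoef (f : nat -> G -> C) (i : nat) : C :=
  limn ((fun k => fcoef (f k) i) : nat -> C^o).

Definition partial_sum (c : nat -> C) (n : nat) (x : G) : C :=
  \sum_(k < n) c k * psi k x.

(* the martingale (S_(M_n) g)_n with which an integrable function g is
   identified; its Hardy norm is that of g *)
Definition fun_mart (g : G -> C) (n : nat) : G -> C :=
  partial_sum (fcoef g) (gen_num m n).

Definition riesz_log (n : nat) : R := \sum_(1 <= k < n.+1) k%:R^-1.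

Definition riesz_mean (f : nat -> G -> C) (n : nat) (x : G) : C :=
  ((riesz_log n)^-1)%:C *
  \sum_(1 <= k < n.+1) partial_sum (mart_fcoef f) k x / k%:R.

End Analysis.

(* Existence of the normalized Haar measure, so that the hypothesis [haar mu]
   is satisfiable: it is the law of the mixed-radix digits of a uniform point
   of [0, 1[. *)
Section Existence.

Variables (R : realType) (m : nat -> nat).
Hypothesis m_ge2 : forall k, (2 <= m k)%N.
Let RB : measurableType _ := measurableTypeR R.
Local Notation G := (vilenkin m).
Local Notation M := (gen_num m).

Definition expansion (t : R) : G := fun k =>
  if (0 <= t < 1) then inZp (Num.truncn (t * (M k.+1)%:R)) else 0.

Lemma gen_num_gt0 k : (0 < M k)%N.
Proof. by elim: k => //= k IH; rewrite muln_gt0 IH (leq_trans _ (m_ge2 k)). Qed.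

Lemma expansion_cylinder n (x : G) : exists j : nat,
  (j < M n)%N /\
  expansion @^-1` cylinder n x `&` `[0, 1[ =
  [set` `[j%:R / (M n)%:R, j.+1%:R / (M n)%:R[ ] :> set R.
Proof.
elim: n => [|n [j [jM IH]]].
  exists 0%N; split=> //; rewrite mul0r divr1.
  by apply/seteqP; split => [t []//|t ?]; split.
have M0 : 0 < (M n)%:R :> R by rewrite ltr0n gen_num_gt0.
have mE : (Zp_trunc (m n)).+2 = m n by apply: Zp_cast; exact: m_ge2.
have m0 : 0 < (m n)%:R :> R by rewrite ltr0n (leq_trans _ (m_ge2 n)).
have xm : (x n < m n)%N by rewrite -[X in (_ < X)%N]mE.
exists (j * m n + x n)%N; split.
  rewrite /= (@leq_trans (j.+1 * m n))//; first by rewrite mulSn; lia.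
  by rewrite mulnC leq_mul2l jM orbT.
apply/seteqP; split => t /=.
- move=> [tx t01].
  have : (expansion @^-1` cylinder n x `&` `[0, 1[) t.
    by split=> // k kn; apply: tx; rewrite ltnS ltnW.
  rewrite IH /= !in_itv /= => /andP[jt tj].
  move: t01 (tx n (ltnSn n)); rewrite /expansion in_itv/= => /[dup] /andP[t0 t1] ->.
  set q := Num.truncn _ => qx0.
  have qx : (q %% m n = x n :> nat)%N by rewrite -qx0 /= [in RHS]mE.
  have /andP[ql qu] : q%:R <= t * (m n * M n)%:R < q.+1%:R.
    by apply: truncn_itv; rewrite mulr_ge0.
  have jq : (j * m n <= q)%N.
    rewrite -ltnS -(@ltr_nat R) (le_lt_trans _ qu)// !natrM mulrA mulrAC ler_pM2r//.
    by rewrite -ler_pdivrMr.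
  have qj : (q < j.+1 * m n)%N.
    rewrite -(@ltr_nat R) (le_lt_trans ql)// !natrM mulrA mulrAC ltr_pM2r//.
    by rewrite -ltr_pdivlMr.
  have -> : (j * m n + x n = q)%N.
    rewrite -qx [RHS](divn_eq q (m n)); congr (_ * _ + _)%N.
    by apply/eqP; rewrite eqn_leq leq_divRL ?jq ?(leq_trans _ (m_ge2 n))//= -ltnS ltn_divLR// (leq_trans _ (m_ge2 n)).
  by rewrite ler_pdivrMr ?ltr_pdivlMr ?ltr0n ?muln_gt0 ?gen_num_gt0 ?(leq_trans _ (m_ge2 n))// ql.
- set q := (j * m n + x n)%N.
  have MM0 : 0 < (m n * M n)%:R :> R by rewrite ltr0n muln_gt0 gen_num_gt0 (leq_trans _ (m_ge2 n)).
  rewrite in_itv /= ler_pdivrMr// ltr_pdivlMr// => /andP[ql qu].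
  have : t \in `[j%:R / (M n)%:R, j.+1%:R / (M n)%:R[.
    rewrite in_itv/= ler_pdivrMr// ltr_pdivlMr//.
    have e : t * (m n * M n)%:R = t * (M n)%:R * (m n)%:R by rewrite natrM; ring.
    rewrite -(ler_pM2r m0) -(ltr_pM2r m0) -e -!natrM.
    rewrite (le_trans _ ql) ?ler_nat ?leq_addr//= (lt_le_trans qu)// ler_nat /q mulSn; lia.
  move=> tj; have : (expansion @^-1` cylinder n x `&` `[0, 1[) t by rewrite IH.
  move=> [tx /= t01]; split=> // k; rewrite ltnS leq_eqVlt => /orP[/eqP->|]; last exact: tx.
  move: (t01); rewrite /expansion in_itv/= => /[dup] /andP[t0 t1] ->.
  have -> : Num.truncn (t * (m n * M n)%:R) = q by apply/truncn_def; rewrite ql qu.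
  apply: val_inj; rewrite /= [in LHS]mE /q modnMDl modn_small//.
Qed.

Lemma measurable_cylinder n (x : G) : measurable (cylinder n x).
Proof. by apply: sub_sigma_algebra; exists n => //; exists x. Qed.

Lemma measurable_expansion : @measurable_fun _ _ RB G setT expansion.
Proof.
apply: (measurability (cylinders m)) => //.
move=> _ [_ [n _ [x _ <-]] <-]; rewrite setTI.
rewrite -(setIT (_ @^-1` _)) -(setUv `[0, 1[%classic) setIUr; apply: measurableU.
  by have [j [_ ->]] := expansion_cylinder n x; exact: measurable_itv.
have [x0|x0] := pselect (cylinder n x 0).
- rewrite (_ : _ `&` _ = ~` `[0, 1[%classic); first by apply: measurableC; exact: measurable_itv.
  apply/seteqP; split => [t []//|t t01]; split => //= k kn.
  rewrite /expansion; case: ifPn => [h|_]; last exact: x0.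
  by exfalso; apply: t01; rewrite /= in_itv.
- rewrite (_ : _ `&` _ = set0)//; apply/seteqP; split => // t [tx t01]; apply: x0 => k kn.
  rewrite -tx// /expansion; case: ifPn => [h|//].
  by exfalso; apply: t01; rewrite /= in_itv.
Qed.

Let mI : measurable (`[0, 1[%classic : set RB).
Proof. exact: measurable_itv. Qed.

Let unit_meas : set RB -> \bar R := mrestr (@lebesgue_measure R) mI.
HB.instance Definition _ := Measure.on unit_meas.

Let unit_measT : unit_meas setT = 1%E.
Proof.
by rewrite /unit_meas /mrestr setTI lebesgue_measure_itv/= lte_fin ltr01 oppr0 adde0.
Qed.
HB.instance Definition _ :=
  Measure_isProbability.Build _ _ _ unit_meas unit_measT.

Let nu : probability G R :=
  distribution unit_meas (@mfun_Sub _ _ RB G _ (mem_set measurable_expansion)).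

Let nu_cylinder n (x : G) : nu (cylinder n x) = ((M n)%:R^-1)%:E.
Proof.
rewrite /nu /distribution /pushforward /= /unit_meas /mrestr.
have [j [_ ->]] := expansion_cylinder n x.
have M0 : 0 < (M n)%:R :> R by rewrite ltr0n gen_num_gt0.
rewrite lebesgue_measure_itv /= lte_fin ltr_pM2r ?invr_gt0// ltr_nat ltnSn.
by rewrite -EFinB -mulrBl -natrB// subSnn mul1r.
Qed.

Let shift (a : G) : G -> G := fun x => a + x.

Lemma shift_cylinder a n (x : G) : shift a @^-1` cylinder n x = cylinder n (x - a).
Proof.
apply/seteqP; split => y yx k kn; rewrite /shift.
  by rewrite /GRing.add/= -(yx k kn) /shift/= addrAC subrr add0r.
have := yx k kn; rewrite /GRing.add/= => ->. by rewrite addrC subrK.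
Qed.

Lemma measurable_shift a : measurable_fun setT (shift a).
Proof.
apply: (measurability (cylinders m)) => //.
move=> _ [_ [n _ [x _ <-]] <-]; rewrite setTI shift_cylinder.
exact: measurable_cylinder.
Qed.

Lemma haar_exists : exists mu : probability G R, haar mu.
Proof.
exists nu => a A mA.
pose H : set (set G) := cylinders m `|` [set set0].
have HE : measurable = <<s H >>.
  apply/seteqP; split.
    by apply: sub_sigma_algebra2 => B; left.
  apply: smallest_sub; first exact: sigma_algebra_measurable.
  by move=> B [mB|->]; [exact: sub_sigma_algebra|exact: measurable0].
apply: (@measure_unique _ R (vilenkin m) H (fun=> setT) HE _ _ _
  (distribution nu (mfun_Sub (mem_set (measurable_shift a)))) nu) => //.
- move=> A1 A2 [[n _ [x _ <-]]|->]; last by right; rewrite set0I.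
  move=> [[k _ [y _ <-]]|->]; last by right; rewrite setI0.
  have [[z [xz yz]]|h] := pselect (cylinder n x `&` cylinder k y !=set0).
    left; exists (maxn n k) => //; exists z => //.
    apply/seteqP; split => u.
      move=> uz; split => i ik.
        by rewrite -xz//; apply: uz; rewrite leq_max ik.
      by rewrite -yz//; apply: uz; rewrite leq_max ik orbT.
    move=> [ux uy] i; rewrite leq_max => /orP[ik|ik]; first by rewrite ux// xz.
    by rewrite uy// yz.
  by right; apply/seteqP; split => // z zh; apply: h; exists z.
- by move=> _; left; exists 0%N => //; exists 0 => //; apply/seteqP; split.
- by apply/seteqP; split => // x _; exists 0%N.
- move=> B [[n _ [x _ <-]]|->]; last by rewrite !measure0.
  rewrite -[LHS]/(nu (shift a @^-1` cylinder n x)) shift_cylinder.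
  by transitivity (((M n)%:R^-1)%:E : \bar R);
    [exact: nu_cylinder|exact/esym/nu_cylinder].
- by move=> _; rewrite (le_lt_trans (probability_le1 _ _)) ?ltry.
Qed.
End Existence.

(* Main.v *)
Require Import Defs.
From mathcomp Require Import all_boot all_order all_algebra.
From mathcomp Require Import complex.
From mathcomp Require Import all_classical all_reals all_analysis.
From mathcomp Require Import measurable_realfun.
From mathcomp Require Import zify ring lra.

(** For n < M_N everything depends only on the first N coordinates, so integrals
    are finite averages.  The martingale f is cut along "principal" cylinders P,
    at which the largest |f| on the children of P has more than doubled since
    the previous principal cylinder: f^(N) is a sum of functions a_P supported in
    P, bounded by three times that maximum h_P, with mean zero unless P is the
    whole group, and sum_P h_P^p mu(P) <= c ||f||_Hp^p because the h_P along a
    point grow geometrically.  By p-subadditivity it remains to bound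
    l_n S_(M_K) R_n a_P, uniformly in K, for P of level r.  It vanishes for
    n < M_r (if P is not the whole group).  On P it is at most a power of log n
    times h_P, since |D_k| <= M_(s+1) at points whose coordinate s is nonzero.
    Off P, grouping the indices k = kappa + M_r q by q and summing by parts in
    kappa bounds it by h_P (M_s M_l / M_r ^ 2) l_(n / M_r), where s < l are the
    first two coordinates in which x differs from P.  The p-th power of M_s M_l
    is integrable uniformly in r because p < 1/2, and the series over n >= M_r
    then contributes the missing factor M_r ^ (2 p - 1). *)

Set Implicit Arguments.
Unset Strict Implicit.
Unset Printing Implicit Defensive.

Import Order.TTheory GRing.Theory Num.Theory.
Import numFieldNormedType.Exports.
Local Open Scope ring_scope.

(** * Coordinates and averages *)

(** For p < 1 Jensen's inequality points the wrong way, so moving the power p inside an average over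
    the M_r cylinders of level r has to go through subadditivity and costs M_r ^ (1 - p). On the
    diagonal this loss is exactly repaid by the small measure of P; off the diagonal the bound
    carries M_r ^ (- p), which leaves M_r ^ (1 - 2 p). The series in n compensates this with room to
    spare: half of the gap 1 - 2 p absorbs all powers of logarithms, the other half keeps the series
    convergent. The factor log^p n itself costs nothing, because log n <= l_n cancels the
    normalization of R_n. The Hardy norm asks for a supremum over K inside the integral. Hence the
    p-th power is first bounded at each point by a majorant that does not mention K, and only this
    majorant is averaged. Boundedness of m is used to replace M_(s+1) by M_s, and to pass from the
    largest |f| on the children of a cylinder, which need not be seen by the maximal function at a
    given point, to |f| itself. *)

Section Coordinates.
Variable m : nat -> nat.
Local Notation G := (vilenkin m).

Definition upd (x : G) (k : nat) (z : 'Z_(m k)) : G := @dfwith _ (fun k => 'Z_(m k)) x k z.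

Lemma upd_in x k (z : 'Z_(m k)) : upd x z k = z.
Proof. exact: dfwith_in. Qed.

Lemma upd_out x k (z : 'Z_(m k)) j : j != k -> upd x z j = x j.
Proof. by move=> jk; apply: dfwith_out; rewrite eq_sym. Qed.

Lemma upd_id x k : upd x (x k) = x.
Proof.
apply: functional_extensionality_dep => j.
by have [->|jk] := eqVneq j k; rewrite ?upd_in ?upd_out.
Qed.

Definition free T (k : nat) (F : G -> T) : Prop :=
  forall x (z : 'Z_(m k)), F (upd x z) = F x.

Definition level T (n : nat) (F : G -> T) : Prop :=
  forall x y, (forall k, (k < n)%N -> x k = y k) -> F x = F y.

Lemma level_free T n k (F : G -> T) : (n <= k)%N -> level n F -> free k F.
Proof.
move=> nk lF x z; apply: lF => j jn; rewrite upd_out //.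
by rewrite neq_ltn (leq_trans jn nk).
Qed.

Lemma level_le T n k (F : G -> T) : (n <= k)%N -> level n F -> level k F.
Proof. by move=> nk lF x y xy; apply: lF => j jn; apply: xy; apply: leq_trans nk. Qed.

Lemma level_comp T U (h : T -> U) n (F : G -> T) :
  level n F -> level n (fun x => h (F x)).
Proof. by move=> lF x y xy; rewrite (lF x y). Qed.

Lemma level_comp2 T1 T2 U (h : T1 -> T2 -> U) n (F1 : G -> T1) (F2 : G -> T2) :
  level n F1 -> level n F2 -> level n (fun x => h (F1 x) (F2 x)).
Proof. by move=> l1 l2 x y xy; rewrite (l1 x y) // (l2 x y). Qed.

Lemma level_sum (V : nmodType) (I : Type) (s : seq I) (P : pred I) n
    (F : I -> G -> V) : (forall i, P i -> level n (F i)) ->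
  level n (fun x => \sum_(i <- s | P i) F i x).
Proof. by move=> lF x y xy; apply: eq_bigr => i Pi; exact: lF. Qed.

End Coordinates.
Arguments free {m T}.
Arguments level {m T}.

Section Averages.
Variables (m : nat -> nat) (V : numFieldType).
Hypothesis m_ge2 : forall k, (2 <= m k)%N.
Local Notation G := (vilenkin m).
Implicit Types (F H : G -> V) (s : seq nat) (x y : G).

Definition avg (k : nat) F (x : G) : V :=
  (m k)%:R^-1 * \sum_(z : 'Z_(m k)) F (upd x z).

(* [cexp (iota r d) F] is the conditional expectation, at level r, of a
   function F of level r + d. *)
Definition cexp s F : G -> V := foldr avg F s.

Lemma card_Zm k : #|{: 'Z_(m k)}| = m k.
Proof. by rewrite card_ord Zp_cast // m_ge2. Qed.

Lemma mk_gt0 k : 0 < (m k)%:R :> V.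
Proof. by rewrite ltr0n (leq_trans _ (m_ge2 k)). Qed.

Lemma avg_free k F x : free k F -> avg k F x = F x.
Proof.
move=> fF; rewrite /avg (eq_bigr (fun=> F x)) => [|z _]; last exact: fF.
by rewrite sumr_const cardT -cardE card_Zm -[F x *+ _]mulr_natl mulKf // gt_eqF ?mk_gt0.
Qed.

Lemma level_avgS n F : level n.+1 F -> level n (avg n F).
Proof.
move=> lF x y xy; rewrite /avg; congr (_ * _); apply: eq_bigr => w _.
apply: lF => j; rewrite ltnS leq_eqVlt => /orP[/eqP->|jn]; first by rewrite !upd_in.
by rewrite !upd_out ?xy // neq_ltn jn.
Qed.

Lemma avg_sum k (I : Type) (t : seq I) (P : pred I) (F : I -> G -> V) x :
  avg k (fun y => \sum_(i <- t | P i) F i y) x = \sum_(i <- t | P i) avg k (F i) x.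
Proof. by rewrite /avg exchange_big -mulr_sumr. Qed.

Lemma avg_pull k F H x : free k H -> avg k (fun y => H y * F y) x = H x * avg k F x.
Proof.
move=> fH; rewrite /avg mulrCA; congr (_ * _); rewrite mulr_sumr.
by apply: eq_bigr => z _; rewrite fH.
Qed.

Lemma cexp_cat s t F : cexp (s ++ t) F = cexp s (cexp t F).
Proof. by rewrite /cexp foldr_cat. Qed.

Lemma cexp_split r k d F : (k <= d)%N ->
  cexp (iota r d) F = cexp (iota r k) (cexp (iota (r + k) (d - k)) F).
Proof. by move=> kd; rewrite -cexp_cat -iotaD subnKC. Qed.

Lemma eq_cexp s F H : (forall x, F x = H x) -> cexp s F = cexp s H.
Proof. by move=> /funext ->. Qed.

Lemma cexp_free s F x : (forall k, k \in s -> free k F) -> cexp s F x = F x.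
Proof.
elim: s x => //= k s IH x fF.
have e : cexp s F = F.
  by apply/funext => y; apply: IH => j js; apply: fF; rewrite in_cons js orbT.
by rewrite e avg_free //; apply: fF; rewrite mem_head.
Qed.

Lemma cexp_level r d F x : level r F -> cexp (iota r d) F x = F x.
Proof.
move=> lF; apply: cexp_free => k; rewrite mem_iota => /andP[rk _].
exact: level_free rk lF.
Qed.

Lemma cexp_cst s (c : V) x : cexp s (fun=> c) x = c.
Proof. by rewrite cexp_free. Qed.

Lemma level_cexp_iota r d F : level (r + d) F -> level r (cexp (iota r d) F).
Proof.
elim: d F => [|d IH] F lF; first by rewrite addn0 in lF.
rewrite -addn1 iotaD cexp_cat; apply: IH; apply: level_avgS.
by rewrite -addnS.
Qed.

Lemma cexp_sum s (I : Type) (t : seq I) (P : pred I) (F : I -> G -> V) x :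
  cexp s (fun y => \sum_(i <- t | P i) F i y) x = \sum_(i <- t | P i) cexp s (F i) x.
Proof.
elim: s x => //= k s IH x.
by rewrite -avg_sum; congr (avg _ _ _); apply/funext => y; exact: IH.
Qed.

Lemma cexpD s F H x : cexp s (fun y => F y + H y) x = cexp s F x + cexp s H x.
Proof.
have := cexp_sum s [:: true; false] xpredT (fun b => if b then F else H) x.
rewrite !big_cons big_nil addr0 => <-; congr (cexp _ _ _).
by apply/funext => y; rewrite !big_cons big_nil addr0.
Qed.

Lemma cexp_pull s F H x : (forall k, k \in s -> free k H) ->
  cexp s (fun y => H y * F y) x = H x * cexp s F x.
Proof.
elim: s x => //= k s IH x fH.
rewrite -avg_pull; last by apply: fH; rewrite mem_head.
congr (avg _ _ _); apply/funext => y; apply: IH => j js; apply: fH.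
by rewrite in_cons js orbT.
Qed.

Lemma cexp_pull_level r d F H x : level r H ->
  cexp (iota r d) (fun y => H y * F y) x = H x * cexp (iota r d) F x.
Proof.
move=> lH; apply: cexp_pull => k; rewrite mem_iota => /andP[rk _].
exact: level_free rk lH.
Qed.

Lemma cexpZ s (c : V) F x : cexp s (fun y => c * F y) x = c * cexp s F x.
Proof. exact: (@cexp_pull s F (fun=> c)). Qed.

Lemma cexp_swap s t (F : G -> G -> V) x y :
  cexp s (fun u => cexp t (F u) y) x = cexp t (fun v => cexp s (F ^~ v) x) y.
Proof.
have aux k u (H : G -> G -> V) : cexp t (fun v => avg k (H ^~ v) u) y =
    avg k (fun w => cexp t (H w) y) u.
  rewrite /avg -cexp_sum -cexpZ; congr (cexp _ _ _).
elim: s x F => //= k s IH x F.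
transitivity (avg k (fun u => cexp t (fun v => cexp s (F ^~ v) u) y) x).
  by congr (avg _ _ _); apply/funext => u; exact: IH.
exact/esym/(aux k x (fun u v => cexp s (F ^~ v) u)).
Qed.

(** Averaging over the coordinates in [s] samples [F] only at points that agree with [x] outside
    [s]. This locality lets a property known on one cylinder be used under the average over it. *)
Lemma eq_cexp_in s F H x :
  (forall y, (forall k, k \notin s -> y k = x k) -> F y = H y) ->
  cexp s F x = cexp s H x.
Proof.
elim: s x => [|k s IH] x FH /=; first exact: FH.
rewrite /avg; congr (_ * _); apply: eq_bigr => z _; apply: IH => y yx.
apply: FH => j; rewrite in_cons negb_or => /andP[jk js].
by rewrite yx // upd_out.
Qed.

Lemma eq_cexp_level r d F H x :
  (forall y, (forall k, (k < r)%N -> y k = x k) -> F y = H y) ->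
  cexp (iota r d) F x = cexp (iota r d) H x.
Proof.
move=> FH; apply: eq_cexp_in => y yx; apply: FH => k kr; apply: yx.
by rewrite mem_iota negb_and -ltnNge kr.
Qed.

Lemma cexp_prod s (phi : forall k, 'Z_(m k) -> V) x : uniq s ->
  cexp s (fun y => \prod_(k <- s) phi k (y k)) x =
  \prod_(k <- s) ((m k)%:R^-1 * \sum_(z : 'Z_(m k)) phi k z).
Proof.
elim: s x => [|k s IH] x /=; first by rewrite !big_nil.
move=> /andP[ks us]; rewrite big_cons /avg -mulrA; congr (_ * _).
rewrite mulr_suml; apply: eq_bigr => z _.
rewrite -(IH (upd x z) us) -cexpZ; apply: eq_cexp_in => y yx.
by rewrite big_cons yx // upd_in.
Qed.

End Averages.


(** * Measures of sets given by prescribed coordinates *)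

Section AgreeAverages.
Variables (m : nat -> nat) (V : numFieldType).
Hypothesis m_ge2 : forall k, (2 <= m k)%N.
Local Notation G := (vilenkin m).
Local Notation M := (gen_num m).
Implicit Types (x y : G).

Lemma gen_numR_gt0 k : 0 < (M k)%:R :> V.
Proof. by rewrite ltr0n gen_num_gt0. Qed.

(** The indicator is a product of functions of one coordinate each: a prescribed coordinate averages
    to [1 / m k], one outside [P] to 1. The predicate covers both full cylinders and sets with one
    coordinate left free. *)
Lemma cexp_all s (P : pred nat) (t x : G) : uniq s ->
  cexp s (fun y => (all (fun k => P k ==> (y k == t k)) s)%:R) x =
  \prod_(k <- s | P k) (m k)%:R^-1 :> V.
Proof.
move=> us.
pose phi k (z : 'Z_(m k)) : V := (P k ==> (z == t k))%:R.
transitivity (cexp s (fun y => \prod_(k <- s) phi k (y k)) x).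
  congr (cexp _ _ _); apply/funext => y.
  elim: s {us} => [|k s IH]; first by rewrite big_nil.
  by rewrite big_cons /= -IH /phi; case: (_ ==> _); rewrite ?mul1r ?mul0r.
rewrite cexp_prod // [RHS]big_mkcond; apply: eq_bigr => k _.
rewrite /phi; case: (P k) => /=.
  rewrite (bigD1 (t k)) //= eqxx big1 ?addr0 ?mulr1 // => z /negbTE -> //.
by rewrite sumr_const cardT -cardE card_Zm // mulVf // gt_eqF ?mk_gt0.
Qed.

Lemma gen_num_prod k : (M k)%:R = \prod_(i <- iota 0 k) (m i)%:R :> V.
Proof.
elim: k => [|k IH]; first by rewrite big_nil.
by rewrite -addn1 iotaD big_cat /= -IH big_seq1 add0n addn1 /= natrM mulrC.
Qed.

Definition agree (n : nat) (x t : G) : bool := all (fun k => x k == t k) (iota 0 n).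

Lemma agreeP n x t : reflect (forall k, (k < n)%N -> x k = t k) (agree n x t).
Proof.
apply: (iffP allP) => [xt k kn|xt k]; first by apply/eqP/xt; rewrite mem_iota.
by rewrite mem_iota => /andP[_ kn]; apply/eqP/xt.
Qed.

Lemma level_agree n t : level n (fun x => agree n x t).
Proof.
by move=> x y xy; apply/agreeP/agreeP => h k kn; rewrite -h // xy.
Qed.

Lemma cexp_agree n d t x : (n <= d)%N ->
  cexp (iota 0 d) (fun y => (agree n y t)%:R) x = (M n)%:R^-1 :> V.
Proof.
move=> nd; rewrite (cexp_split _ _ nd).
rewrite (@eq_cexp _ V (iota 0 n) _ (fun y => (agree n y t)%:R)); last first.
  move=> y; apply: cexp_level => //.
  exact: (level_comp (fun b : bool => b%:R : V) (@level_agree n t)).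
have := @cexp_all (iota 0 n) xpredT t x (iota_uniq _ _).
by rewrite prodfV -gen_num_prod.
Qed.

End AgreeAverages.

(** * Inequalities for averages and for powers p <= 1 *)

Section RealAverages.
Variables (R : realType) (m : nat -> nat).
Hypothesis m_ge2 : forall k, (2 <= m k)%N.
Local Notation G := (vilenkin m).
Local Notation M := (gen_num m).
Implicit Types (F H : G -> R) (s : seq nat) (x y : G).

Lemma cexp_le_in s F H x :
  (forall y, (forall k, k \notin s -> y k = x k) -> F y <= H y) ->
  cexp s F x <= cexp s H x.
Proof.
elim: s x => [|k s IH] x FH /=; first exact: FH.
rewrite /avg ler_pM2l ?invr_gt0 ?mk_gt0 //.
apply: ler_sum => z _; apply: IH => y yx.
apply: FH => j; rewrite in_cons negb_or => /andP[jk js].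
by rewrite yx // upd_out.
Qed.

Lemma cexp_le s F H x : (forall y, F y <= H y) -> cexp s F x <= cexp s H x.
Proof. by move=> FH; apply: cexp_le_in => y _; exact: FH. Qed.

Lemma cexp_le_level r d F H x :
  (forall y, (forall k, (k < r)%N -> y k = x k) -> F y <= H y) ->
  cexp (iota r d) F x <= cexp (iota r d) H x.
Proof.
move=> FH; apply: cexp_le_in => y yx; apply: FH => k kr; apply: yx.
by rewrite mem_iota negb_and -ltnNge kr.
Qed.

Lemma cexp_ge0 s F x : (forall y, 0 <= F y) -> 0 <= cexp s F x.
Proof.
by move=> F0; rewrite -[leLHS](cexp_cst m_ge2 s (0 : R) x); exact: cexp_le.
Qed.

(** Within the cylinder of level [r] around [x], the cylinder of level [n] around [t] has relative
    measure [M r / M n] or is missed altogether. *)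
Lemma cexp_agree_tail r n d t x : (r <= n <= r + d)%N ->
  cexp (iota r d) (fun y => (agree n y t)%:R) x <= (M r)%:R / (M n)%:R :> R.
Proof.
move=> /andP[rn nd].
rewrite (@cexp_split _ _ r (n - r) d) ?leq_subLR //.
rewrite (@eq_cexp _ R (iota r _) _ (fun y => (agree n y t)%:R)); last first.
  move=> y; apply: cexp_level => //; rewrite subnKC //.
  exact: (level_comp (fun b : bool => b%:R : R) (@level_agree m n t)).
have := @cexp_all m R m_ge2 (iota r (n - r)) xpredT t x (iota_uniq _ _).
have -> : \prod_(k <- iota r (n - r)) (m k)%:R^-1 = (M r)%:R / (M n)%:R :> R.
  rewrite prodfV [in RHS]gen_num_prod [X in _ / X]gen_num_prod.
  rewrite -[in X in _ / X](subnKC rn) iotaD big_cat /= add0n invfM mulrA.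
  by rewrite divff ?mul1r // -gen_num_prod gt_eqF ?gen_numR_gt0.
move=> <-; apply: cexp_le => y; rewrite ler_nat.
have [yt|//] := boolP (agree n y t).
rewrite (_ : all _ _ = true) //; apply/allP => k /=.
by rewrite mem_iota subnKC // => /andP[_ kn]; apply/eqP/(agreeP _ _ _ yt).
Qed.

Lemma normc_sum (I : Type) (s : seq I) (P : pred I) (F : I -> R[i]) :
  Normc.normc (\sum_(i <- s | P i) F i) <= \sum_(i <- s | P i) Normc.normc (F i).
Proof.
elim/big_rec2: _ => [|i y z _ h]; first by rewrite Normc.normc0.
by rewrite (le_trans (le_normcD _ _)) // lerD2l.
Qed.

Lemma normc_nat n : Normc.normc (n%:R : R[i]) = n%:R.
Proof.
by rewrite -[n%:R]/((1 : R[i]) *+ n) normcMn Normc.normc1.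
Qed.

Lemma normc_ge0 (z : R[i]) : 0 <= Normc.normc z.
Proof. by case: z => a b; exact: sqrtr_ge0. Qed.

Lemma normc_cexp s (F : G -> R[i]) x :
  Normc.normc (cexp s F x) <= cexp s (fun y => Normc.normc (F y)) x.
Proof.
elim: s x => //= k s IH x.
rewrite /avg Normc.normcM Normc.normcV normc_nat ler_pM2l ?invr_gt0 ?mk_gt0 //.
by apply: le_trans (normc_sum _ _ _) _; apply: ler_sum.
Qed.

Lemma powR_subadd (p a b : R) : 0 < p <= 1 -> 0 <= a -> 0 <= b ->
  (a + b) `^ p <= a `^ p + b `^ p.
Proof.
move=> /andP[p0 p1] a0 b0; have [ab|ab] := ltP 0 (a + b); last first.
  have -> : a = 0 by lra.
  have -> : b = 0 by lra.
  by rewrite addr0 powR0 ?gt_eqF // addr0.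
(* Since 0 <= c / (a + b) <= 1 and p <= 1, this ratio is at most its p-th power; the cases c = a and
   c = b add up to the claim. *)
have sub c : 0 <= c <= a + b -> (a + b) `^ p * (c / (a + b)) <= c `^ p.
  move=> /andP[c0 cab].
  have -> : c `^ p = (a + b) `^ p * (c / (a + b)) `^ p.
    by rewrite -powRM ?divr_ge0 ?(ltW ab) // mulrC divfK // gt_eqF.
  rewrite ler_pM2l ?powR_gt0 //.
  move: c0; rewrite le_eqVlt => /orP[/eqP<-|c0]; first by rewrite mul0r powR_ge0.
  by apply: ger1_powR => //; rewrite divr_gt0 //= ler_pdivrMr // mul1r.
rewrite (le_trans _ (lerD (sub a _) (sub b _))) //.
- by rewrite -mulrDr -mulrDl divff ?mulr1 // gt_eqF.
- by rewrite a0 lerDl.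
- by rewrite b0 lerDr.
Qed.

Lemma powR_sum_subadd (p : R) (I : Type) (s : seq I) (P : pred I) (F : I -> R) :
  0 < p <= 1 -> (forall i, 0 <= F i) ->
  (\sum_(i <- s | P i) F i) `^ p <= \sum_(i <- s | P i) F i `^ p.
Proof.
move=> /[dup] pp /andP[p0 p1] F0.
elim: s => [|i s IH]; first by rewrite !big_nil powR0 // gt_eqF.
rewrite !big_cons; case: ifP => // _.
rewrite (le_trans (powR_subadd pp _ _)) ?sumr_ge0 // lerD2l //.
Qed.

(** Each average is treated as a sum: [(m k)^-p = (m k)^(1 - p) * (m k)^-1], and the excess factors
    [(m k)^(1 - p)] accumulate along [s]. *)
Lemma cexp_powR_subadd (p : R) s F x : 0 < p <= 1 -> (forall y, 0 <= F y) ->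
  (cexp s F x) `^ p <=
  (\prod_(k <- s) (m k)%:R) `^ (1 - p) * cexp s (fun y => F y `^ p) x.
Proof.
move=> /[dup] pp /andP[p0 p1] F0; elim: s x => [|k s IH] x /=.
  by rewrite big_nil powR1 mul1r.
have mk0 : 0 < (m k)%:R :> R by apply: mk_gt0.
rewrite big_cons powRM ?prodr_ge0 // ?ler0n // /avg.
have S0 : 0 <= \sum_(z : 'Z_(m k)) cexp s F (upd x z).
  by apply: sumr_ge0 => z _; exact: cexp_ge0.
rewrite powRM ?invr_ge0 ?(ltW mk0) //.
have -> : (m k)%:R^-1 `^ p = (m k)%:R `^ (1 - p) * (m k)%:R^-1 :> R.
  rewrite -powR_inv1 ?(ltW mk0) // -powRrM -powRD ?(gt_eqF mk0) ?implybT //.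
  by congr (_ `^ _); ring.
rewrite -!mulrA ler_pM2l ?powR_gt0 // mulrCA ler_pM2l ?invr_gt0 // mulr_sumr.
apply: le_trans (powR_sum_subadd _ _ pp _) _ => [z|]; first exact: cexp_ge0.
by apply: ler_sum => z _; exact: IH.
Qed.

End RealAverages.

(** * Vilenkin characters and Dirichlet kernels *)

Section GenNum.
Variable m : nat -> nat.
Hypothesis m_ge2 : forall k, (2 <= m k)%N.
Local Notation M := (gen_num m).

Lemma gen_num_ge k : (2 ^ k <= M k)%N.
Proof. by elim: k => //= k IH; rewrite expnS leq_mul // m_ge2. Qed.

Lemma gen_num_dvd j k : (j <= k)%N -> (M j %| M k)%N.
Proof.
move=> /subnK <-; elim: (k - j)%N => //= d IH.
by rewrite dvdn_mull.
Qed.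

Lemma leq_gen_num j k : (j <= k)%N -> (M j <= M k)%N.
Proof. by move=> jk; apply: dvdn_leq (gen_num_dvd jk); apply: gen_num_gt0. Qed.

Lemma ltn_gen_num n : (n < M n)%N.
Proof. by apply: leq_trans (gen_num_ge n); exact: ltn_expl. Qed.

Lemma digit_ge n k : (n < M k)%N -> digit m n k = 0%N.
Proof. by move=> nk; rewrite /digit divn_small // mod0n. Qed.

Lemma digitD_lt i k u j : (j < k)%N -> digit m (i + M k * u) j = digit m i j.
Proof.
move=> jk; have /dvdnP[c ->] := gen_num_dvd jk.
have -> : (c * M j.+1 * u = c * u * m j * M j)%N by rewrite /=; ring.
by rewrite /digit addnC divnMDl ?gen_num_gt0 // modnMDl.
Qed.

Lemma digitD_ge i k u j : (i < M k)%N -> (k <= j)%N ->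
  digit m (i + M k * u) j = digit m (M k * u) j.
Proof.
move=> ik kj; have /dvdnP[c jE] := gen_num_dvd kj.
have M0 : (0 < M k)%N by apply: gen_num_gt0.
have divE v : (v %/ M j = v %/ M k %/ c)%N by rewrite jE mulnC divnMA.
rewrite /digit !divE addnC [(M k * u)%N]mulnC divnMDl // mulnK //.
by rewrite (divn_small ik) addn0.
Qed.

Lemma digitM_lt k u j : (j < k)%N -> digit m (M k * u) j = 0%N.
Proof. by move=> jk; rewrite -(add0n (_ * _)%N) digitD_lt // /digit div0n mod0n. Qed.

End GenNum.

Section Characters.
Variables (R : realType).
Local Notation C := R[i].

Lemma expiD (s t : R) : expi (s + t) = expi s * expi t.
Proof. by rewrite /expi cosD sinD; simpc; congr (_ +i* _)%C; ring. Qed.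

Lemma expi0 : expi 0 = 1 :> C.
Proof. by rewrite /expi cos0 sin0. Qed.

Lemma expiX (t : R) n : expi (t * n%:R) = expi t ^+ n.
Proof.
elim: n => [|n IH]; first by rewrite mulr0 expi0.
by rewrite -addn1 natrD mulrDr mulr1 expiD IH addn1 exprSr.
Qed.

Lemma normc_expi (t : R) : Normc.normc (expi t) = 1.
Proof. by rewrite /expi /= cos2Dsin2 sqrtr1. Qed.

Lemma expi_conj (t : R) : expi t * (expi t)^*%C = 1.
Proof.
rewrite /expi /=; simpc; rewrite -!expr2 cos2Dsin2.
by congr (_ +i* _)%C; ring.
Qed.

Lemma expi_neq1 (t : R) : 0 < t < 2 * pi -> expi t != 1.
Proof.
move=> /andP[t0 t2]; apply/eqP => -[c1 _].
have t2E : t = t / 2 + t / 2 by rewrite -splitr.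
move: c1; rewrite t2E cosD.
have s0 : 0 < sin (t / 2) by apply: sin_gt0_pi; apply/andP; split; lra.
have := cos2Dsin2 (t / 2); nra.
Qed.

Definition zeta (n : nat) : C := expi (2 * pi / n%:R).

Lemma zetaX n j : zeta n ^+ j = expi (2 * pi * j%:R / n%:R).
Proof. by rewrite -expiX mulrAC. Qed.

Lemma zeta_prim n : (0 < n)%N -> n.-primitive_root (zeta n).
Proof.
move=> n0; have nR : 0 < n%:R :> R by rewrite ltr0n.
apply/andP; split => //; apply/forallP => i; apply/eqP.
have p0 := pi_gt0 R.
rewrite unity_rootE zetaX; have [->|ni] := eqVneq i.+1 n.
  rewrite mulfK ?(gt_eqF nR) //; apply/eqP.
  by rewrite mulr_natl /expi cos2pi sin2pi.
apply/negbTE/expi_neq1; rewrite divr_gt0 ?mulr_gt0 ?ltr0n //=.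
rewrite ltr_pdivrMr // ltr_pM2l ?mulr_gt0 // ltr_nat ltn_neqAle ni //=.
Qed.

Lemma sum_unity_root (K : idomainType) (w : K) n : w ^+ n = 1 -> w != 1 ->
  \sum_(i < n) w ^+ i = 0.
Proof.
move=> wn w1; have := subrX1 w n; rewrite wn subrr => /esym/eqP.
by rewrite mulf_eq0 subr_eq0 (negbTE w1) /= => /eqP.
Qed.

Variable m : nat -> nat.
Hypothesis m_ge2 : forall k, (2 <= m k)%N.
Local Notation G := (vilenkin m).
Local Notation M := (gen_num m).

Lemma rademacherE k (x : G) : rademacher R k x = zeta (m k) ^+ (x k).
Proof. by rewrite zetaX. Qed.

Lemma zeta_prim_m k : (m k).-primitive_root (zeta (m k)).
Proof. by apply: zeta_prim; rewrite (leq_trans _ (m_ge2 k)). Qed.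

Lemma ltn_Zm k (z : 'Z_(m k)) : (z < m k)%N.
Proof. by rewrite -[X in (_ < X)%N](Zp_cast (m_ge2 k)). Qed.

Lemma zeta_add k (z w : 'Z_(m k)) :
  zeta (m k) ^+ (z + w)%R = zeta (m k) ^+ z * zeta (m k) ^+ w.
Proof.
have -> : ((z + w)%R = (z + w) %% m k :> nat)%N.
  by rewrite /=; congr (_ %% _)%N; exact: Zp_cast.
by rewrite (prim_expr_mod (zeta_prim_m k)) exprD.
Qed.

Lemma rademacher_norm k (x : G) : rademacher R k x * (rademacher R k x)^*%C = 1.
Proof. exact: expi_conj. Qed.

Lemma rademacherB k (x t : G) :
  rademacher R k (x - t) = rademacher R k x * (rademacher R k t)^*%C.
Proof.
have xE : rademacher R k x = rademacher R k (x - t) * rademacher R k t.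
  by rewrite !rademacherE -zeta_add -[(x - t) k]/(x k - t k) subrK.
by rewrite xE -mulrA rademacher_norm mulr1.
Qed.

Lemma psiE n K (x : G) : (n < M K)%N ->
  psi R n x = \prod_(k < K) rademacher R k x ^+ digit m n k.
Proof.
move=> nK; have ext a b : (a <= b)%N -> (n < M a)%N ->
    \prod_(k < a) rademacher R k x ^+ digit m n k =
    \prod_(k < b) rademacher R k x ^+ digit m n k.
  move=> ab na; rewrite -!(big_mkord xpredT (fun k => rademacher R k x ^+ digit m n k)).
  rewrite (big_cat_nat _ ab) //= [X in _ * X]big_nat_cond [X in _ * X]big1 ?mulr1 //.
  move=> k /andP[/andP[ak _] _]; rewrite digit_ge //.
  exact: leq_trans na (leq_gen_num m_ge2 ak).
rewrite /psi (ext n (maxn n K)) ?leq_maxl ?ltn_gen_num //.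
by rewrite (ext K (maxn n K)) ?leq_maxr.
Qed.

Lemma level_psi n K : (n < M K)%N -> level K (psi R n : G -> C).
Proof.
move=> nK x y xy; rewrite !(psiE _ nK); apply: eq_bigr => k _.
by rewrite !rademacherE xy.
Qed.

Lemma normc_psi n (x : G) : Normc.normc (psi R n x) = 1.
Proof.
rewrite /psi; elim/big_rec: _ => [|k z _ h]; first by rewrite Normc.normc1.
rewrite Normc.normcM h mulr1.
elim: (digit _ _ _) => [|j IH]; first by rewrite Normc.normc1.
by rewrite exprS Normc.normcM IH mulr1 normc_expi.
Qed.

Lemma psiB n (x t : G) : psi R n (x - t) = psi R n x * (psi R n t)^*%C.
Proof.
rewrite /psi rmorph_prod -big_split; apply: eq_bigr => k _.
by rewrite rademacherB exprMn rmorphXn.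
Qed.

(** No carry occurs: below [k] the sum has the digits of [i], from [k] on those of [M k * u]. *)
Lemma psiD i k u (x : G) : (i < M k)%N ->
  psi R (i + M k * u) x = psi R i x * psi R (M k * u) x.
Proof.
move=> ik; set n := (i + M k * u)%N.
have nn := ltn_gen_num m_ge2 n.
have le_n a : (a <= n)%N -> (a < M n)%N by move=> an; exact: leq_ltn_trans an nn.
rewrite (psiE x nn) (psiE x (le_n i _)) ?leq_addr //.
rewrite (psiE x (le_n (M k * u)%N _)) ?leq_addl // -big_split.
apply: eq_bigr => -[j jn] _ /=; have [jk|kj] := ltnP j k.
  by rewrite digitD_lt // digitM_lt // mulr1.
rewrite digitD_ge // (digit_ge (n := i)) ?mul1r //.
exact: leq_trans ik (leq_gen_num m_ge2 kj).
Qed.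

Lemma psiM_top k u (x : G) : (u < m k)%N ->
  psi R (M k * u) x = rademacher R k x ^+ u.
Proof.
move=> uk; rewrite (psiE (K := k.+1)) /=; last by rewrite mulnC ltn_pmul2r ?gen_num_gt0.
rewrite big_ord_recr /= big1 => [|j _]; last by rewrite digitM_lt.
by rewrite mul1r /digit mulKn ?gen_num_gt0 // modn_small.
Qed.

Lemma psiM_eq k u (x y : G) : (forall j, (k <= j)%N -> x j = y j) ->
  psi R (M k * u) x = psi R (M k * u) y.
Proof.
move=> xy; apply: eq_bigr => -[j jn] _ /=; have [jk|kj] := ltnP j k.
  by rewrite digitM_lt.
by rewrite !rademacherE xy.
Qed.

Lemma sum_blocks (V : nmodType) (F : nat -> V) a q :
  \sum_(i < a * q) F i = \sum_(u < q) \sum_(i < a) F (i + a * u)%N.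
Proof.
elim: q => [|q IH]; first by rewrite muln0 !big_ord0.
rewrite mulnS addnC big_split_ord /= IH big_ord_recr /=; congr (_ + _).
by apply: eq_bigr => i _; rewrite addnC.
Qed.

Lemma sum_blocks_rem (V : nmodType) (F : nat -> V) a n :
  \sum_(i < n) F i = \sum_(u < n %/ a) \sum_(i < a) F (i + a * u)%N +
    \sum_(i < n %% a) F (i + a * (n %/ a))%N.
Proof.
rewrite -sum_blocks; set q := (n %/ a)%N; set c := (n %% a)%N.
have -> : n = (a * q + c)%N by rewrite [LHS](divn_eq n a) mulnC.
by rewrite big_split_ord /=; congr (_ + _); apply: eq_bigr => i _; rewrite addnC.
Qed.

Definition dirichlet (n : nat) (y : G) : C := \sum_(k < n) psi R k y.

Lemma dirichletM k q y :
  dirichlet (M k * q) y = dirichlet (M k) y * \sum_(u < q) psi R (M k * u) y.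
Proof.
rewrite /dirichlet (sum_blocks (fun i => psi R i y)) mulr_sumr.
apply: eq_bigr => u _; rewrite mulr_suml; apply: eq_bigr => i _.
by rewrite psiD.
Qed.

Lemma dirichletMD k q i y : (i <= M k)%N ->
  dirichlet (i + M k * q) y =
  dirichlet (M k) y * \sum_(u < q) psi R (M k * u) y +
  psi R (M k * q) y * dirichlet i y.
Proof.
move=> ik; rewrite addnC {1}/dirichlet big_split_ord /= -dirichletM.
congr (_ + _); rewrite mulr_sumr; apply: eq_bigr => j _ /=.
by rewrite addnC psiD 1?mulrC // (leq_trans (ltn_ord j)).
Qed.

(** Paley's lemma. The induction splits off a sum of all powers of [rademacher k y], which is [m k]
    if [y k = 0] and otherwise a complete sum of powers of a nontrivial root of unity. *)
Lemma dirichlet_gen_num k y :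
  dirichlet (M k) y = (if agree k y 0 then (M k)%:R else 0).
Proof.
elim: k => [|k IH].
  by rewrite /dirichlet big_ord_recl big_ord0 addr0 /psi big_ord0.
have -> : agree k.+1 y 0 = (y k == 0) && agree k y 0.
  by rewrite /agree -addn1 iotaD all_cat /= andbT andbC.
rewrite {1}[M k.+1]mulnC dirichletM IH.
rewrite (eq_bigr (fun u : 'I_(m k) => rademacher R k y ^+ u)); last first.
  by move=> u _; rewrite psiM_top.
have [yk|yk] := eqVneq (y k) 0; last first.
  rewrite sum_unity_root ?mulr0 // rademacherE.
    by rewrite exprAC (prim_expr_order (zeta_prim_m k)) expr1n.
  rewrite -(prim_order_dvd (zeta_prim_m k)) gtnNdvd ?ltn_Zm //.
  by rewrite lt0n; apply: contra yk => /eqP yk; apply/eqP/val_inj.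
rewrite rademacherE yk /= expr0 (eq_bigr (fun=> 1)) => [|u _]; last by rewrite expr1n.
rewrite sumr_const card_ord; case: ifP => _; last by rewrite mul0r.
by rewrite -natrM mulnC.
Qed.

Lemma normc_dirichlet n y : Normc.normc (dirichlet n y) <= n%:R.
Proof.
apply: le_trans (normc_sum _ _ _) _.
rewrite (eq_bigr (fun=> 1)) => [|k _]; last exact: normc_psi.
by rewrite sumr_const card_ord.
Qed.

Lemma dirichlet_gen_num0 n s y : y s != 0 -> (s < n)%N -> dirichlet (M n) y = 0.
Proof.
move=> ys sn; rewrite dirichlet_gen_num; case: ifP => // /agreeP /(_ s sn) y0.
by rewrite y0 eqxx in ys.
Qed.

(** Every complete block of length [M k] carries the factor [dirichlet (M k) y], which vanishes;
    only the incomplete last block survives. *)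
Lemma dirichlet_off n k s y : y s != 0 -> (s < k)%N ->
  dirichlet n y = psi R (M k * (n %/ M k)) y * dirichlet (n %% M k) y.
Proof.
move=> ys sk; rewrite {1}(divn_eq n (M k)) addnC [(_ %/ _ * _)%N]mulnC.
rewrite dirichletMD; last by rewrite ltnW // ltn_mod gen_num_gt0.
by rewrite (dirichlet_gen_num0 ys sk) mul0r add0r.
Qed.

Lemma normc_dirichlet_off n s y : y s != 0 ->
  Normc.normc (dirichlet n y) <= (M s.+1)%:R.
Proof.
move=> ys; rewrite (dirichlet_off n ys (ltnSn s)) Normc.normcM normc_psi mul1r.
apply: le_trans (normc_dirichlet _ _) _; rewrite ler_nat ltnW // ltn_mod.
exact: gen_num_gt0.
Qed.

Lemma normc_sum_psiM_off k q l (y : G) : y l != 0 -> (k <= l)%N ->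
  Normc.normc (\sum_(u < q) psi R (M k * u) y) <= (M l.+1)%:R / (M k)%:R.
Proof.
(* The characters of index [M k * u] ignore coordinates below [k]. Once these are set to 0,
   [dirichlet (M k)] equals [M k], so the sum is [dirichlet (M k * q) / M k] and the pointwise bound
   at [l] applies. *)
move=> yl kl; pose y' : G := fun j => if (j < k)%N then 0 else y j.
rewrite (eq_bigr (fun u : 'I_q => psi R (M k * u) y')) => [|u _]; last first.
  by apply: psiM_eq => j kj; rewrite /y' ltnNge kj.
rewrite ler_pdivlMr ?gen_numR_gt0 // mulrC.
have := dirichletM k q y'; rewrite dirichlet_gen_num ifT; last first.
  by apply/agreeP => j jk; rewrite /y' jk.
move=> /(congr1 (@Normc.normc _)); rewrite Normc.normcM normc_nat => <-.
by apply: normc_dirichlet_off; rewrite /y' ltnNge kl.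
Qed.

(** Cut the sum into blocks of length [M s.+1]. As [dirichlet (M s.+1) y = 0], block [u] is the
    first block, of size at most [(M s.+1)^2], times [psi (M s.+1 * u) y]. The sum of these
    characters is at most [b * M l / M s.+1], by cancellation at the coordinate [l], or by counting
    them if [l = r]. The complete blocks and the remainder give the factor 2. *)
Lemma normc_fejer_off b s l r kap (y : G) : (forall k, (m k <= b)%N) ->
  y s != 0 -> (s < l <= r)%N -> (l == r) || (y l != 0) -> (kap <= M r)%N ->
  Normc.normc (\sum_(i < kap) dirichlet i y) <= 2 * b%:R ^+ 2 * (M s)%:R * (M l)%:R.
Proof.
move=> mb ys /andP[sl lr] yl kr.
have Mb k : (M k.+1)%:R <= b%:R * (M k)%:R :> R.
  by rewrite -natrM ler_nat leq_mul.
have Ms := gen_numR_gt0 R m_ge2 s.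
have MS := gen_numR_gt0 R m_ge2 s.+1.
have MSn : (0 < M s.+1)%N by apply: gen_num_gt0.
have Ml := gen_numR_gt0 R m_ge2 l.
have b1 : 1 <= b%:R :> R by rewrite ler1n (leq_trans _ (mb 0%N)) // (leq_trans _ (m_ge2 0%N)).
set q := (kap %/ M s.+1)%N; set c := (kap %% M s.+1)%N.
have cM : (c <= M s.+1)%N by rewrite ltnW // ltn_mod.
have partial j u : (j <= M s.+1)%N ->
    Normc.normc (\sum_(i < j) dirichlet (i + M s.+1 * u)%N y) <= j%:R * (M s.+1)%:R.
  move=> jM; apply: le_trans (normc_sum _ _ _) _.
  rewrite -[X in X%:R * _](card_ord j) mulr_natl -sumr_const; apply: ler_sum => i _.
  exact: normc_dirichlet_off.
have -> : \sum_(i < kap) dirichlet i y =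
    (\sum_(i < M s.+1) dirichlet i y) * (\sum_(u < q) psi R (M s.+1 * u) y) +
    \sum_(i < c) dirichlet (i + M s.+1 * q)%N y.
  rewrite (sum_blocks_rem (fun i => dirichlet i y) (M s.+1)) mulr_sumr.
  congr (_ + _); apply: eq_bigr => u _.
  rewrite mulr_suml; apply: eq_bigr => i _.
  rewrite dirichletMD; last exact: ltnW.
  by rewrite (dirichlet_gen_num0 ys (ltnSn s)) mul0r add0r mulrC.
apply: le_trans (le_normcD _ _) _; rewrite Normc.normcM.
have sum_q : Normc.normc (\sum_(u < q) psi R (M s.+1 * u) y) <=
    b%:R * (M l)%:R / (M s.+1)%:R.
  have [lrE|lr'] := eqVneq l r; last first.
    move: yl; rewrite (negbTE lr') /= => yl.
    apply: le_trans (normc_sum_psiM_off q yl sl) _.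
    by rewrite ler_pM2r ?invr_gt0.
  apply: le_trans (normc_sum _ _ _) _.
  rewrite (eq_bigr (fun=> 1)) => [|u _]; last exact: normc_psi.
  rewrite sumr_const card_ord ler_pdivlMr // -natrM -natrM ler_nat.
  apply: leq_trans (leq_divM _ _) _; rewrite (leq_trans kr) // lrE.
  by rewrite leq_pmull // -(ltr_nat R) (lt_le_trans _ b1).
have h1 := partial (M s.+1) 0%N (leqnn _).
rewrite (eq_bigr (fun i : 'I_(M s.+1) => dirichlet i y)) in h1; last first.
  by move=> i _; rewrite muln0 addn0.
have h2 := partial c q cM.
have h3 : c%:R * (M s.+1)%:R <= (M s.+1)%:R * (M s.+1)%:R :> R.
  by rewrite -!natrM ler_nat leq_mul2r cM orbT.
have h4 : (M s.+1)%:R <= (M l)%:R :> R by rewrite ler_nat leq_gen_num.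
have h5 := Mb s.
have h12 := ler_pM (normc_ge0 _) (normc_ge0 _) h1 sum_q.
apply: le_trans (lerD h12 (le_trans h2 h3)) _.
rewrite mulrA -(mulrA (M s.+1)%:R (M s.+1)%:R) [(M s.+1)%:R * (_ * _)]mulrC.
rewrite [_ * (b%:R * (M l)%:R)]mulrC -!mulrA mulfV ?gt_eqF // mulr1.
set S := (M s.+1)%:R in MS h3 h4 h5 *; set L := (M l)%:R in Ml h4 *.
set S0 := (M s)%:R in Ms h5 *; set B := b%:R in b1 h5 *.
have e1 : B * (L * S) <= B * (L * (B * S0)) by rewrite !ler_pM2l // (lt_le_trans _ b1).
have e2 : S * S <= L * (B * S0) by apply: ler_pM => //; exact: ltW.
have e3 : L * (B * S0) <= B * (L * (B * S0)).
  by rewrite ler_peMl // !mulr_ge0 // ?ltW // (lt_le_trans _ b1).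
have -> : 2 * (B * (B * (S0 * L))) = B * (L * (B * S0)) + B * (L * (B * S0)) by ring.
by apply: lerD => //; exact: le_trans e2 e3.
Qed.

End Characters.

(** * Averages of the Riesz kernel *)

Section KernelAverages.
Variables (R : realType) (m : nat -> nat) (b : nat).
Hypothesis m_ge2 : forall k, (2 <= m k)%N.
Hypothesis m_le : forall k, (m k <= b)%N.
Local Notation C := R[i].
Local Notation G := (vilenkin m).
Local Notation M := (gen_num m).
Local Notation normc := (@Normc.normc R).
Local Notation dirichlet := (@dirichlet R m).
Implicit Types (x y t u : G) (a : G -> C).

(** The index 0 is harmless because [0^-1 = 0]; starting there aligns the sum with blocks of length
    [M r]. *)
Lemma riesz_logE n : riesz_log R n = \sum_(k < n.+1) k%:R^-1.
Proof. by rewrite /riesz_log big_ord_recl /= invr0 add0r big_add1 big_mkord. Qed.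

Lemma riesz_log_ge0 n : 0 <= riesz_log R n.
Proof. by rewrite riesz_logE sumr_ge0. Qed.

Lemma le_riesz_log n n' : (n <= n')%N -> riesz_log R n <= riesz_log R n'.
Proof.
move=> nn; rewrite /riesz_log [leRHS](big_cat_nat _ _ (n := n.+1)) //=.
by rewrite lerDl sumr_ge0.
Qed.

Lemma abel_bound (w : nat -> R) (c : nat -> C) (B : R) N :
  (forall k, 0 <= w k) -> (forall k, w k.+1 <= w k) ->
  (forall k, (k <= N)%N -> normc (\sum_(i < k) c i) <= B) ->
  normc (\sum_(k < N) (w k)%:C%C * c k) <= w 0%N * B.
Proof.
move=> w0 wS cB.
have wB k : 0 <= w k * B by rewrite mulr_ge0 // (le_trans _ (cB 0%N _)) ?normc_ge0.
have normcR (z : R) : 0 <= z -> normc z%:C%C = z.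
  by move=> z0; rewrite /= expr0n /= addr0 sqrtr_sqr ger0_norm.
(* Summation by parts as an induction: once the boundary term is removed, each step adds
   [w k - w k.+1] times a partial sum, and these weights telescope. *)
have key : forall k, (k <= N)%N ->
  normc (\sum_(i < k) (w i)%:C%C * c i - (w k)%:C%C * \sum_(i < k) c i)
    <= (w 0%N - w k) * B.
  elim=> [_|k IH kN]; first by rewrite !big_ord0 mulr0 subr0 subrr mul0r Normc.normc0.
  have wk : 0 <= w k - w k.+1 by rewrite subr_ge0.
  have -> : \sum_(i < k.+1) (w i)%:C%C * c i - (w k.+1)%:C%C * \sum_(i < k.+1) c i =
      (\sum_(i < k) (w i)%:C%C * c i - (w k)%:C%C * \sum_(i < k) c i) +
      (w k - w k.+1)%:C%C * \sum_(i < k.+1) c i.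
    by rewrite !big_ord_recr /= rmorphB /=; ring.
  apply: le_trans (le_normcD _ _) _.
  have := IH (ltnW kN); rewrite Normc.normcM normcR //.
  have := ler_wpM2l wk (cB _ kN); lra.
rewrite -[X in normc X](subrK ((w N)%:C%C * \sum_(i < N) c i)).
apply: le_trans (le_normcD _ _) _.
have := key N (leqnn N); have := ler_wpM2l (w0 N) (cB N (leqnn N)).
rewrite Normc.normcM normcR //; lra.
Qed.

Lemma level_dirichlet k r : (k <= M r)%N -> level r (dirichlet k).
Proof.
by move=> kr; apply: level_sum => i _; apply: level_psi => //; exact: leq_trans kr.
Qed.

(* [riesz_kernel n Q] is the kernel of l_n S_Q R_n. *)
Definition riesz_kernel (n Q : nat) y : C :=
  \sum_(k < n.+1) k%:R^-1 * dirichlet (minn k Q) y.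

Lemma level_shift T r (F : G -> T) x : level r F -> level r (fun u : G => F (x - u)).
Proof.
move=> lF u v uv; apply: lF => k kr.
by rewrite -[LHS]/(x k - u k) -[RHS]/(x k - v k) uv.
Qed.

Lemma cexp_dirichlet0 a r d k x t : (k <= M r)%N -> cexp (iota r d) a t = 0 ->
  cexp (iota r d) (fun u => a u * dirichlet k (x - u)) t = 0.
Proof.
move=> kr a0; rewrite (eq_cexp _ (H := fun u => dirichlet k (x - u) * a u)).
  rewrite cexp_pull_level ?a0 ?mulr0 //.
  exact: level_shift (level_dirichlet kr).
by move=> u; rewrite mulrC.
Qed.

Lemma cexp_riesz_kernel a r d n Q x t :
  cexp (iota r d) (fun u => a u * riesz_kernel n Q (x - u)) t =
  \sum_(k < n.+1) k%:R^-1 *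
    cexp (iota r d) (fun u => a u * dirichlet (minn k Q) (x - u)) t.
Proof.
rewrite (eq_cexp _ (H := fun u => \sum_(k < n.+1)
    k%:R^-1 * (a u * dirichlet (minn k Q) (x - u)))).
  by rewrite cexp_sum; apply: eq_bigr => k _; rewrite cexpZ.
by move=> u; rewrite mulr_sumr; apply: eq_bigr => k _; rewrite mulrCA.
Qed.

Lemma cexp_riesz_kernel0 a r d n Q x t : (n <= M r)%N ->
  cexp (iota r d) a t = 0 ->
  cexp (iota r d) (fun u => a u * riesz_kernel n Q (x - u)) t = 0.
Proof.
move=> nr a0; rewrite cexp_riesz_kernel big1 // => k _.
rewrite cexp_dirichlet0 ?mulr0 // (leq_trans (geq_minl _ _)) //.
by rewrite (leq_trans _ nr) // -ltnS ltn_ord.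
Qed.

Section OffDiagonal.
Variables (a : G -> C) (A : R) (r d s l : nat) (x t : G).
Hypothesis aA : forall u, (forall k, (k < r)%N -> u k = t k) -> normc (a u) <= A.
Hypothesis a0 : cexp (iota r d) a t = 0.
Hypothesis xts : (x - t) s != 0.
Hypothesis slr : (s < l <= r)%N.
Hypothesis xtl : (l == r) || ((x - t) l != 0).

Let s_lt_r : (s < r)%N. Proof. by case/andP: slr => sl; exact: leq_trans. Qed.

Let Mr := gen_numR_gt0 R m_ge2 r.

(** For [k = kappa + M r * q] and [u] in the cylinder of [t], [dirichlet k (x - u)] is
    [psi (M r * q) (x - u)] times a factor constant in [u]; [alpha q] is what remains of the
    average. *)
Let alpha q := cexp (iota r d) (fun u => a u * psi R (M r * q) (x - u)) t.

Let normc_alpha q : normc (alpha q) <= A.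
Proof.
apply: le_trans (normc_cexp m_ge2 _ _ _) _.
rewrite -[leRHS](cexp_cst m_ge2 (iota r d) A t); apply: cexp_le_level => //.
by move=> u ut; rewrite Normc.normcM normc_psi mulr1 aA.
Qed.

Let alpha0 : alpha 0 = 0.
Proof.
rewrite -a0; apply: eq_cexp_level => u _.
by rewrite muln0 /psi big_ord0 mulr1.
Qed.

Let cexp_dirichlet k :
  cexp (iota r d) (fun u => a u * dirichlet k (x - u)) t =
  alpha (k %/ M r) * dirichlet (k %% M r) (x - t).
Proof.
rewrite mulrC /alpha -cexpZ; apply: eq_cexp_level => u ut.
have xus : (x - u) s != 0.
  by rewrite -[(x - u) s]/(x s - u s) ut.
rewrite (dirichlet_off _ m_ge2 _ xus s_lt_r) mulrA mulrC; congr (_ * _).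
apply: level_shift ut; apply: level_dirichlet.
by rewrite ltnW // ltn_mod gen_num_gt0.
Qed.

Let B : R := 2 * b%:R ^+ 2 * (M s)%:R * (M l)%:R.

(** For [q > 0] the weights decrease in [kap] from [1 / (M r * q)], so summation by parts applies to
    the bound on sums of Dirichlet kernels. The block [q = 0] vanishes because [a] has mean zero, in
    agreement with [0^-1 = 0]. *)
Let block q c : (c <= M r)%N ->
  normc (\sum_(kap < c) (kap + M r * q)%:R^-1 *
    cexp (iota r d) (fun u => a u * dirichlet (kap + M r * q) (x - u)) t) <=
  A * B / (M r)%:R * q%:R^-1.
Proof.
move=> cr; have M0 : (0 < M r)%N by apply: gen_num_gt0.
have A0 : 0 <= A by apply: le_trans (aA (u := t) _) => //; exact: normc_ge0.
have [->|q0] := posnP q.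
  rewrite big1 ?Normc.normc0 ?invr0 ?mulr0 // => kap _.
  by rewrite cexp_dirichlet muln0 addn0 divn_small ?(leq_trans _ cr) // alpha0 mul0r mulr0.
rewrite (eq_bigr (fun kap : 'I_c => alpha q *
    (((kap + M r * q)%:R^-1)%:C%C * dirichlet kap (x - t)))); last first.
  move=> kap _; have kr : (kap < M r)%N by apply: leq_trans cr.
  rewrite cexp_dirichlet [(M r * q)%N]mulnC addnC divnMDl // modnMDl.
  by rewrite divn_small // modn_small // addn0 mulrCA fmorphV rmorph_nat.
rewrite -mulr_sumr Normc.normcM.
have -> : A * B / (M r)%:R * q%:R^-1 = A * (((0 + M r * q)%:R)^-1 * B).
  by rewrite add0n natrM invfM; ring.
apply: ler_pM; rewrite ?normc_ge0 //.
apply: (@abel_bound (fun k => (k + M r * q)%:R^-1) (fun k => dirichlet k (x - t)) B c) => [k|k|k kc].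
- by rewrite invr_ge0.
- by rewrite lef_pV2 ?posrE ?ltr0n ?addn_gt0 ?muln_gt0 ?M0 ?q0 ?orbT // ler_nat leq_add2r.
- by apply: normc_fejer_off xtl _ => //; exact: leq_trans cr.
Qed.

Let sum_dirichlet N : (0 < N)%N ->
  normc (\sum_(k < N) k%:R^-1 *
    cexp (iota r d) (fun u => a u * dirichlet k (x - u)) t) <=
  A * B / (M r)%:R * riesz_log R (N.-1 %/ M r).
Proof.
move=> N0; have M0 : (0 < M r)%N by apply: gen_num_gt0.
rewrite (sum_blocks_rem (fun k => k%:R^-1 *
  cexp (iota r d) (fun u => a u * dirichlet k (x - u)) t) (M r)).
have A0 : 0 <= A by apply: le_trans (aA (u := t) _) => //; exact: normc_ge0.
have AB : 0 <= A * B / (M r)%:R by rewrite !mulr_ge0.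
apply: le_trans (le_normcD _ _) _.
have full q : normc (\sum_(u < q) \sum_(i < M r) (i + M r * u)%:R^-1 *
   cexp (iota r d) (fun u0 => a u0 * dirichlet (i + M r * u) (x - u0)) t) <=
   A * B / (M r)%:R * \sum_(u < q) u%:R^-1.
  apply: le_trans (normc_sum _ _ _) _; rewrite mulr_sumr.
  by apply: ler_sum => u _; exact: block.
(* If [M r] divides [N] there is no incomplete block and the harmonic sum ends one term earlier;
   this is the reason for [N.-1]. *)
have [c0|c0] := posnP (N %% M r).
  rewrite c0 big_ord0 Normc.normc0 addr0; apply: le_trans (full _) _.
  have q0 : (0 < N %/ M r)%N.
    by rewrite divn_gt0 //; apply: dvdn_leq => //; rewrite /dvdn c0.
  rewrite -(prednK q0) -riesz_logE ler_wpM2l //; apply: le_riesz_log.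
  rewrite leq_divRL // -ltnS (prednK N0) (@leq_trans (N %/ M r * M r)) ?leq_divM //.
  by rewrite ltn_pmul2r // prednK.
have -> : (N.-1 %/ M r = N %/ M r)%N.
  apply/eqP; rewrite eqn_leq leq_div2r ?leq_pred //= leq_divRL // -ltnS prednK //.
  by rewrite {2}(divn_eq N (M r)) -[leqLHS]addn1 leq_add2l.
apply: le_trans (lerD (full _) (block _ _)) _; first by rewrite ltnW // ltn_mod.
by rewrite -mulrDr riesz_logE big_ord_recr.
Qed.

(** Uniform in [K]: for [K <= r] all kernels are constant on the cylinder and the mean of [a] kills
    them; for [K > r] the terms with [k >= M K] vanish with [dirichlet (M K) (x - u)], so the sum is
    merely truncated. *)
Lemma normc_off_diagonal n K :
  normc (cexp (iota r d) (fun u => a u * riesz_kernel n (M K) (x - u)) t) <=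
  A * (2 * b%:R ^+ 2 * (M s)%:R * (M l)%:R) / (M r)%:R * riesz_log R (n %/ M r).
Proof.
rewrite cexp_riesz_kernel.
have A0 : 0 <= A by apply: le_trans (aA (u := t) _) => //; exact: normc_ge0.
have AB : 0 <= A * B / (M r)%:R by rewrite !mulr_ge0.
have [Kr|rK] := leqP K r.
  rewrite big1 ?Normc.normc0 ?mulr_ge0 ?riesz_log_ge0 // => k _.
  rewrite cexp_dirichlet0 ?mulr0 //.
  by rewrite (leq_trans (geq_minr _ _)) // leq_gen_num.
have MK : (0 < M K)%N by apply: gen_num_gt0.
have DK0 : cexp (iota r d) (fun u => a u * dirichlet (M K) (x - u)) t = 0.
  rewrite -(cexp_cst m_ge2 (iota r d) (0 : C) t); apply: eq_cexp_level => u ut.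
  rewrite (@dirichlet_gen_num0 _ _ _ _ s) ?mulr0 ?(ltn_trans s_lt_r) //.
  by rewrite -[(x - u) s]/(x s - u s) ut.
pose N := minn n.+1 (M K).
have N0 : (0 < N)%N by rewrite leq_min.
suff -> : \sum_(k < n.+1) k%:R^-1 *
    cexp (iota r d) (fun u => a u * dirichlet (minn k (M K)) (x - u)) t =
    \sum_(k < N) k%:R^-1 *
    cexp (iota r d) (fun u => a u * dirichlet k (x - u)) t.
  apply: le_trans (sum_dirichlet N0) _; apply: ler_wpM2l => //.
  apply: le_riesz_log; apply: leq_div2r; rewrite -ltnS prednK // geq_minl //.
rewrite -(big_mkord xpredT (fun k => k%:R^-1 *
    cexp (iota r d) (fun u => a u * dirichlet k (x - u)) t)).
rewrite -(big_mkord xpredT (fun k => k%:R^-1 *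
    cexp (iota r d) (fun u => a u * dirichlet (minn k (M K)) (x - u)) t)).
rewrite (big_cat_nat (n := N)) ?geq_minl //= [X in _ + X]big_nat_cond.
rewrite [X in _ + X]big1 ?addr0 => [|k /andP[/andP[Nk kn] _]]; last first.
  rewrite (minn_idPr _) ?DK0 ?mulr0 //.
  by move: Nk; rewrite geq_min leqNgt kn.
apply: eq_big_nat => k /andP[_ kN]; rewrite (minn_idPl _) // ltnW //.
by rewrite (leq_trans kN) // geq_minr.
Qed.

End OffDiagonal.

(** The term of the first nonzero coordinate [s < J] already dominates, as [M s.+1 <= b * M s]; if
    there is none, the term [s = J] does. The full sum has the advantage that its averages are
    explicit. *)
Lemma normc_dirichlet_le k J y : (k <= M J)%N ->
  normc (dirichlet k y) <= \sum_(s < J.+1) b%:R * (M s)%:R * (agree s y 0)%:R.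
Proof.
move=> kJ; have b1 : 1 <= b%:R :> R.
  by rewrite ler1n (leq_trans _ (m_le 0%N)) // (leq_trans _ (m_ge2 0%N)).
have term (s : 'I_J.+1) : 0 <= b%:R * (M s)%:R * (agree s y 0)%:R :> R by rewrite !mulr_ge0.
have pick (s : 'I_J.+1) : agree s y 0 ->
    b%:R * (M s)%:R <= \sum_(s < J.+1) b%:R * (M s)%:R * (agree s y 0)%:R :> R.
  by move=> sy; rewrite (bigD1 s) //= sy mulr1 lerDl sumr_ge0.
have [yJ|] := boolP (agree J y 0).
  apply: le_trans (normc_dirichlet _ _ _) _; apply: le_trans _ (pick ord_max yJ).
  by rewrite /= (@le_trans _ _ (M J)%:R) ?ler_nat // ler_peMl.
move=> /allPn[s']; rewrite mem_iota => /= s'J ys'.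
have ex : exists s, (s < J)%N && (y s != 0) by exists s'; rewrite s'J.
case: (ex_minnP ex) => s /andP[sJ ys] smin.
apply: le_trans (normc_dirichlet_off R m_ge2 k ys) _.
apply: le_trans _ (pick (Ordinal (ltnW sJ : (s < J.+1)%N)) _); last first.
  apply/agreeP => j /= js; apply/eqP; apply: contraT => yj.
  by have := smin j; rewrite yj (ltn_trans js sJ) => /(_ isT); rewrite leqNgt js.
by rewrite /= -natrM ler_nat leq_mul.
Qed.

Lemma normc_riesz_kernel_le n Q J y : (n <= M J)%N ->
  normc (riesz_kernel n Q y) <=
  riesz_log R n * \sum_(s < J.+1) b%:R * (M s)%:R * (agree s y 0)%:R.
Proof.
move=> nJ; apply: le_trans (normc_sum _ _ _) _.
rewrite riesz_logE mulr_suml; apply: ler_sum => k _.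
rewrite Normc.normcM Normc.normcV normc_nat ler_wpM2l ?invr_ge0 //.
apply: normc_dirichlet_le; rewrite (leq_trans (geq_minl _ _)) //.
by rewrite (leq_trans _ nJ) // -ltnS.
Qed.

(** Relative to the cylinder of level [r], the set where [u] and [x] agree up to [s] has measure at
    most [M r / M s], so each of the [J + 1] terms contributes at most [b * M r]. *)
Lemma normc_diagonal a (A : R) r d x t n Q J :
  (forall u, (forall k, (k < r)%N -> u k = t k) -> normc (a u) <= A) ->
  (n <= M J)%N -> (J <= r + d)%N ->
  normc (cexp (iota r d) (fun u => a u * riesz_kernel n Q (x - u)) t) <=
  A * (M r)%:R * (b%:R * J.+1%:R * riesz_log R n).
Proof.
move=> aA nJ Jrd.
have A0 : 0 <= A by apply: le_trans (aA t _) => //; exact: normc_ge0.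
apply: le_trans (normc_cexp m_ge2 _ _ _) _.
pose W u : R := A * riesz_log R n *
  \sum_(s < J.+1) b%:R * (M s)%:R * (agree s u x)%:R.
apply: (@le_trans _ _ (cexp (iota r d) W t)).
  apply: cexp_le_level => // u ut; rewrite Normc.normcM /W -mulrA.
  apply: ler_pM; rewrite ?normc_ge0 ?aA //.
  apply: le_trans (normc_riesz_kernel_le _ _ nJ) _.
  apply: ler_wpM2l; first exact: riesz_log_ge0.
  apply: ler_sum => s _; apply: ler_wpM2l; first by rewrite mulr_ge0.
  rewrite ler_nat; case: (boolP (agree s (x - u) 0)) => // /agreeP tu.
  rewrite (_ : agree s u x = true) //; apply/agreeP => k ks.
  by have := tu k ks; rewrite -[LHS]/(x k - u k) => /eqP; rewrite subr_eq0 => /eqP.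
rewrite /W cexpZ cexp_sum.
rewrite -!mulrA [_ * (b%:R * _)]mulrCA ler_wpM2l // [leRHS]mulrCA.
rewrite [leRHS](_ : _ = riesz_log R n * (b%:R * J.+1%:R * (M r)%:R)); last by ring.
rewrite ler_wpM2l ?riesz_log_ge0 //.
apply: (@le_trans _ _ (\sum_(s < J.+1) b%:R * (M r)%:R)).
  apply: ler_sum => s _; rewrite cexpZ -mulrA ler_wpM2l //.
  have Ms := gen_numR_gt0 R m_ge2 s.
  rewrite mulrC -ler_pdivlMr //; have [sr|rs] := leqP s r.
    apply: (@le_trans _ _ 1).
      rewrite -[leRHS](cexp_cst m_ge2 (iota r d) (1 : R) t).
      by apply: cexp_le => // u; rewrite lern1 leq_b1.
    by rewrite ler_pdivlMr // mul1r ler_nat leq_gen_num.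
  apply: cexp_agree_tail => //; rewrite ltnW //= (leq_trans _ Jrd) //.
  by rewrite -ltnS.
by rewrite sumr_const card_ord -mulr_natr; lra.
Qed.

End KernelAverages.

(** * Integrability of the off-diagonal kernel *)

Lemma gen_num_ge_mul (m : nat -> nat) (s l : nat) : (forall k, (2 <= m k)%N) ->
  (s <= l)%N -> (2 ^ (l - s) * gen_num m s <= gen_num m l)%N.
Proof.
move=> m_ge2 /subnKC <-; rewrite addKn; elim: (l - s)%N => [|j IH].
  by rewrite mul1n addn0.
by rewrite expnS -mulnA addnS /= leq_mul.
Qed.

Section AtomEstimate.
Variables (R : realType) (m : nat -> nat) (b : nat) (p : R).
Hypothesis m_ge2 : forall k, (2 <= m k)%N.
Hypothesis m_le : forall k, (m k <= b)%N.
Hypothesis p_gt0 : 0 < p.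
Hypothesis p_lt : 2 * p < 1.
Local Notation C := R[i].
Local Notation G := (vilenkin m).
Local Notation M := (gen_num m).
Local Notation normc := (@Normc.normc R).
Implicit Types (x y t u : G) (a : G -> C).

Definition almost_agree (s l : nat) x t : bool :=
  all (fun k => (k != s) ==> (x k == t k)) (iota 0 l).

(** [s] is the first coordinate at which the points differ, [l] the second one, or [r] if no second
    one lies below [r]. *)
Lemma not_agree_split r x t : ~~ agree r x t -> exists s l,
  [/\ (s < l <= r)%N, (x - t) s != 0, (l == r) || ((x - t) l != 0)
    & almost_agree s l x t].
Proof.
move=> /allPn[s']; rewrite mem_iota /= => s'r xts'.
have exs : exists s, (s < r)%N && (x s != t s) by exists s'; rewrite s'r.
case: (ex_minnP exs) => s /andP[sr xts] smin.
have exl : exists l, (s < l)%N && ((l == r) || (x l != t l)).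
  by exists r; rewrite sr eqxx.
case: (ex_minnP exl) => l /andP[sl xtl] lmin.
have lr : (l <= r)%N by apply: lmin; rewrite sr eqxx.
exists s, l; split=> //; first by rewrite sl.
- by rewrite -[(x - t) s]/(x s - t s) subr_eq0.
- by rewrite -[(x - t) l]/(x l - t l) subr_eq0.
apply/allP => k; rewrite mem_iota /= => kl; apply/implyP => ks.
apply: contraT => xtk; move: ks; rewrite neq_ltn => /orP[ks|sk].
  by have := smin k; rewrite xtk (leq_trans kl lr) => /(_ isT); rewrite leqNgt ks.
by have := lmin k; rewrite xtk sk orbT => /(_ isT); rewrite leqNgt kl.
Qed.

Lemma level_almost_agree s l t : level l (fun x => almost_agree s l x t).
Proof.
move=> x y xy; apply: eq_in_all => k; rewrite mem_iota => /andP[_ kl].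
by rewrite xy.
Qed.

Lemma cexp_almost_agree s l d t x : (s < l <= d)%N ->
  cexp (iota 0 d) (fun y => (almost_agree s l y t)%:R) x <= b%:R / (M l)%:R :> R.
Proof.
move=> /andP[sl ld]; rewrite (cexp_split _ _ ld).
rewrite (@eq_cexp _ R (iota 0 l) _ (fun y => (almost_agree s l y t)%:R)); last first.
  move=> y; apply: cexp_level => //.
  exact: (level_comp (fun b : bool => b%:R : R) (@level_almost_agree s l t)).
have -> : cexp (iota 0 l) (fun y => (almost_agree s l y t)%:R) x =
    \prod_(k <- iota 0 l | k != s) (m k)%:R^-1 :> R.
  exact: (cexp_all R m_ge2 (fun k => k != s) t x (iota_uniq _ _)).
rewrite ler_pdivlMr ?gen_numR_gt0 // gen_num_prod prodfV.
rewrite (bigD1_seq s) ?iota_uniq ?mem_iota //= mulrCA mulVf ?mulr1 ?ler_nat //.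
by rewrite prodf_seq_neq0; apply/allP => k _; apply/implyP => _; rewrite gt_eqF // mk_gt0.
Qed.

(* Summing over all pairs s < l instead of selecting the first two coordinates
   where x and t differ makes the average over x a sum of products. *)
Definition off_weight r x t : R := \sum_(s < r) \sum_(l < r.+1 | (s < l)%N)
  (2 * b%:R ^+ 2 * (M s)%:R * (M l)%:R) `^ p * (almost_agree s l x t)%:R.

Lemma off_weight_ge0 r x t : 0 <= off_weight r x t.
Proof. by apply: sumr_ge0 => s _; apply: sumr_ge0 => l _; rewrite mulr_ge0 ?powR_ge0. Qed.

Lemma geometric_sum_le (th : R) n : 0 <= th < 1 -> \sum_(i < n) th ^+ i <= (1 - th)^-1.
Proof.
move=> /andP[t0 t1]; rewrite -[leRHS]mul1r ler_pdivlMr ?subr_gt0 //.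
have := subrX1 th n; have := exprn_ge0 n t0; lra.
Qed.

Lemma powR_nat_exp (c : R) k : ((2 ^ k)%N%:R) `^ c = (2 `^ c) ^+ k.
Proof. by rewrite natrX -!powR_mulrn ?powR_ge0 // powRAC. Qed.

Lemma powR_neg_le (c u v : R) : c <= 0 -> 0 < u -> u <= v -> v `^ c <= u `^ c.
Proof.
move=> c0 u0 uv; have v0 := lt_le_trans u0 uv.
have cE : c = - (- c) by rewrite opprK.
rewrite cE; move: c0; rewrite -oppr_ge0 => {cE}; move: (- c) => e e0.
rewrite !powRN lef_pV2 ?posrE ?powR_gt0 //.
by apply: ge0_ler_powR; rewrite ?nnegrE ?(ltW u0) ?(ltW v0).
Qed.

Definition off_const : R := b%:R * (2 * b%:R ^+ 2) `^ p *
  ((1 - 2 `^ (2 * p - 1))^-1 * (1 - 2 `^ (p - 1))^-1).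

Lemma powR2_lt1 (c : R) : c < 0 -> 0 <= (2 : R) `^ c < 1.
Proof.
move=> c0; rewrite powR_ge0 /= -[c]opprK powRN invf_lt1 ?powR_gt0 //.
by rewrite /powR gt_eqF // expR_gt1 mulr_gt0 ?oppr_gt0 // ln_gt0 ?ltr1n.
Qed.

(** The measure [m s / M l] turns the sum into one of [(M s)^p * (M l)^(p - 1)]. By
    [M l >= 2^(l - s) * M s] the sum over [l] is geometric with ratio [2^(p - 1)]; what is left,
    [(M s)^(2 * p - 1) <= 2^((2 * p - 1) * s)], is summable exactly because [2 * p < 1]. *)
Lemma cexp_off_weight r d t x : (r <= d)%N ->
  cexp (iota 0 d) (fun y => off_weight r y t) x <= off_const.
Proof.
move=> rd; rewrite cexp_sum.
have p1 : p - 1 < 0 by have := p_lt; have := p_gt0; lra.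
have p2 : 2 * p - 1 < 0 by have := p_lt; lra.
pose th : R := 2 `^ (2 * p - 1); pose eta : R := 2 `^ (p - 1).
have th1 : 0 <= th < 1 by exact: powR2_lt1.
have eta1 : 0 <= eta < 1 by exact: powR2_lt1.
have b0 : 0 <= (2 * b%:R ^+ 2 : R) by rewrite mulr_ge0 ?exprn_ge0.
pose K := b%:R * (2 * b%:R ^+ 2) `^ p.
have K0 : 0 <= K by rewrite mulr_ge0 ?powR_ge0.
apply: (@le_trans _ _ (\sum_(s < r) K * (th ^+ s * (1 - eta)^-1))); last first.
  rewrite -mulr_sumr -mulr_suml /off_const ler_wpM2l // ler_wpM2r ?geometric_sum_le //.
  by rewrite invr_ge0 subr_ge0 ltW //; case/andP: eta1.
apply: ler_sum => s _; rewrite cexp_sum.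
have term (l : 'I_r.+1) : (s < l)%N ->
    cexp (iota 0 d) (fun y => (2 * b%:R ^+ 2 * (M s)%:R * (M l)%:R) `^ p *
      (almost_agree s l y t)%:R) x <= K * (th ^+ s * eta ^+ (l - s)).
  move=> sl; rewrite cexpZ.
  have Ms := gen_numR_gt0 R m_ge2 s; have Ml := gen_numR_gt0 R m_ge2 l.
  apply: (@le_trans _ _ ((2 * b%:R ^+ 2 * (M s)%:R * (M l)%:R) `^ p * (b%:R / (M l)%:R))).
    rewrite ler_wpM2l ?powR_ge0 // cexp_almost_agree // sl /=.
    by rewrite (leq_trans _ rd) // -ltnS.
  have -> : (2 * b%:R ^+ 2 * (M s)%:R * (M l)%:R) `^ p * (b%:R / (M l)%:R) =
      K * ((M s)%:R `^ p * (M l)%:R `^ (p - 1)).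
    rewrite /K; move: (2 * b%:R ^+ 2) b0 => c c0.
    rewrite powRM ?mulr_ge0 // powRM // powRD ?(gt_eqF Ml) ?implybT //.
    by rewrite powR_inv1 //; ring.
  apply: ler_wpM2l => //.
  have Mls : (2 ^ (l - s))%N%:R * (M s)%:R <= (M l)%:R :> R.
    by rewrite -natrM ler_nat gen_num_ge_mul // ltnW.
  have e0 : 0 < (2 ^ (l - s))%N%:R :> R by rewrite ltr0n expn_gt0.
  apply: (@le_trans _ _ ((M s)%:R `^ p * (eta ^+ (l - s) * (M s)%:R `^ (p - 1)))).
    rewrite ler_wpM2l ?powR_ge0 // -powR_nat_exp -powRM ?(ltW e0) ?(ltW Ms) //.
    by apply: powR_neg_le (ltW p1) _ _ => //; rewrite mulr_gt0.
  rewrite mulrCA -powRD ?(gt_eqF Ms) ?implybT // mulrC.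
  have -> : p + (p - 1) = 2 * p - 1 by ring.
  apply: ler_wpM2r; first by rewrite exprn_ge0 //; case/andP: eta1.
  rewrite -powR_nat_exp; apply: powR_neg_le (ltW p2) _ _; first by rewrite ltr0n expn_gt0.
  by rewrite ler_nat gen_num_ge.
apply: le_trans (ler_sum _ term) _.
rewrite -mulr_sumr ler_wpM2l // -mulr_sumr ler_wpM2l ?exprn_ge0 //; first by case/andP: th1.
rewrite -(big_mkord (fun l => (s < l)%N) (fun l => eta ^+ (l - s))).
apply: le_trans (geometric_sum_le r.+1 eta1).
rewrite -(big_mkord xpredT (fun l => eta ^+ l)).
rewrite (big_cat_nat (n := s)) //=; last by rewrite (leq_trans (ltnW (ltn_ord s))).
rewrite big_nat_cond big_pred0 ?add0r => [|l]; last first.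
  by apply/negP => /andP[/andP[_ ls] /(ltn_trans ls)]; rewrite ltnn.
rewrite -{1}(add0n (s : nat)) big_addn [leRHS](big_cat_nat (n := r.+1 - s)) ?leq_subr //=.
rewrite -[leLHS]addr0 lerD //; last by apply: sumr_ge0 => i _; rewrite exprn_ge0 //; case/andP: eta1.
rewrite big_mkcond; apply: ler_sum => i _; case: ifP => _; first by rewrite addnK.
by rewrite exprn_ge0 //; case/andP: eta1.
Qed.

End AtomEstimate.

(** * The p-th power estimate for one atom *)

Section AtomPower.
Variables (R : realType) (m : nat -> nat) (b : nat) (p : R).
Hypothesis m_ge2 : forall k, (2 <= m k)%N.
Hypothesis m_le : forall k, (m k <= b)%N.
Hypothesis p_gt0 : 0 < p.
Hypothesis p_lt : 2 * p < 1.
Local Notation C := R[i].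
Local Notation G := (vilenkin m).
Local Notation M := (gen_num m).
Local Notation normc := (@Normc.normc R).
Implicit Types (x y t u : G) (a : G -> C) (A : G -> R).

Let p01 : 0 < p <= 1.
Proof. by apply/andP; split => //; have := p_lt; have := p_gt0; lra. Qed.

(** The p-th powers of the diagonal and the off-diagonal bound for the cylinder of [t], evaluated at
    [x]; [K] stands for the logarithmic factor on the diagonal, [H] for [l_(n / M r)]. *)
Definition atom_weight A r (K H : R) x t : R :=
  (agree r x t)%:R * (A t * (M r)%:R * K) `^ p +
  (A t / (M r)%:R * H) `^ p * off_weight b p r x t.

Lemma atom_weight_ge0 A r K H x t : 0 <= atom_weight A r K H x t.
Proof.
by rewrite addr_ge0 // mulr_ge0 ?powR_ge0 // off_weight_ge0.
Qed.

Lemma off_weight_ge r x t s l : (s < l <= r)%N -> almost_agree s l x t ->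
  (2 * b%:R ^+ 2 * (M s)%:R * (M l)%:R) `^ p <= off_weight b p r x t.
Proof.
move=> /andP[sl lr] xt; have sr : (s < r)%N by apply: leq_trans lr.
have term (i : 'I_r) (j : 'I_r.+1) :
    0 <= (2 * b%:R ^+ 2 * (M i)%:R * (M j)%:R) `^ p * (almost_agree i j x t)%:R.
  by rewrite mulr_ge0 ?powR_ge0.
rewrite /off_weight (bigD1 (Ordinal sr)) //=.
rewrite (bigD1 (Ordinal (lr : (l < r.+1)%N))) //= xt mulr1 -addrA lerDl.
by rewrite addr_ge0 ?sumr_ge0 // => i _; rewrite sumr_ge0.
Qed.

Lemma atom_pointwise a A r d n J K x x0 :
  level r A -> (forall u, normc (a u) <= A u) ->
  ((0 < r)%N -> forall t, cexp (iota r d) a t = 0) ->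
  (n <= M J)%N -> (J <= r + d)%N ->
  normc (cexp (iota 0 (r + d)) (fun u => a u * riesz_kernel R n (M K) (x - u)) x0) `^ p
  <= (M r)%:R `^ (1 - p) * cexp (iota 0 r)
    (atom_weight A r (b%:R * J.+1%:R * riesz_log R n) (riesz_log R (n %/ M r)) x) x0.
Proof.
move=> lA aA a0 nJ Jrd.
have A0 u : 0 <= A u by apply: le_trans (aA u); exact: normc_ge0.
pose g t := cexp (iota r d) (fun u => a u * riesz_kernel R n (M K) (x - u)) t.
rewrite iotaD cexp_cat add0n -/g.
apply: (@le_trans _ _ ((cexp (iota 0 r) (fun t => normc (g t)) x0) `^ p)).
  apply: ge0_ler_powR; rewrite ?nnegrE ?normc_ge0 ?(ltW p_gt0) //.
    by apply: cexp_ge0 => // t; exact: normc_ge0.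
  exact: normc_cexp.
apply: le_trans (cexp_powR_subadd m_ge2 _ _ p01 _) _; first by move=> t; exact: normc_ge0.
rewrite -gen_num_prod ler_wpM2l ?powR_ge0 //; apply: cexp_le => // t.
have aAt u : (forall k, (k < r)%N -> u k = t k) -> normc (a u) <= A t.
  by move=> ut; rewrite -(lA _ _ ut).
have Mr := gen_numR_gt0 R m_ge2 r.
rewrite /atom_weight; have [xt|xt] := boolP (agree r x t).
  rewrite mul1r; apply: (@le_trans _ _ ((A t * (M r)%:R * (b%:R * J.+1%:R * riesz_log R n)) `^ p)).
    apply: ge0_ler_powR; rewrite ?nnegrE ?normc_ge0 ?(ltW p_gt0) //.
      by rewrite !mulr_ge0 // riesz_log_ge0.
    exact: normc_diagonal.
  by rewrite lerDl mulr_ge0 ?powR_ge0 // off_weight_ge0.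
rewrite mul0r add0r.
have [s [l [slr xts xtl xtsl]]] := not_agree_split xt.
(* Two points can only disagree below [r] if [r > 0], which is the case where [a] has mean zero. *)
have r0 : (0 < r)%N by case/andP: slr => sl; exact: leq_trans (leq_ltn_trans _ sl).
apply: (@le_trans _ _ ((A t * (2 * b%:R ^+ 2 * (M s)%:R * (M l)%:R) / (M r)%:R *
    riesz_log R (n %/ M r)) `^ p)).
  apply: ge0_ler_powR; rewrite ?nnegrE ?normc_ge0 ?(ltW p_gt0) //.
    by rewrite !mulr_ge0 ?invr_ge0 ?exprn_ge0 // riesz_log_ge0.
  by apply: (normc_off_diagonal m_ge2 m_le aAt (a0 r0 t) xts slr xtl).
have -> : A t * (2 * b%:R ^+ 2 * (M s)%:R * (M l)%:R) / (M r)%:R * riesz_log R (n %/ M r) =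
  (A t / (M r)%:R * riesz_log R (n %/ M r)) * (2 * b%:R ^+ 2 * (M s)%:R * (M l)%:R).
  by ring.
rewrite powRM; last 2 first.
- by rewrite !mulr_ge0 ?invr_ge0 // riesz_log_ge0.
- by rewrite !mulr_ge0 ?exprn_ge0.
by rewrite ler_wpM2l ?powR_ge0 // off_weight_ge.
Qed.

(** By Fubini [x] is averaged first, for fixed [t]. The powers of [M r] are [(1 - p) + p - 1 = 0] on
    the diagonal, where agreement has measure [1 / M r], and [(1 - p) - p] off it. *)
Lemma atom_mean A r N K H x0 : (r <= N)%N -> 0 <= K -> 0 <= H ->
  (forall t, 0 <= A t) ->
  cexp (iota 0 N) (fun x => (M r)%:R `^ (1 - p) *
    cexp (iota 0 r) (atom_weight A r K H x) x0) x0 <=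
  (K `^ p + off_const b p * (M r)%:R `^ (1 - 2 * p) * H `^ p) *
    cexp (iota 0 r) (fun t => A t `^ p) x0.
Proof.
move=> rN K0 H0 A0; have Mr := gen_numR_gt0 R m_ge2 r.
rewrite cexpZ (cexp_swap _ _ (fun x t => atom_weight A r K H x t)) -!cexpZ.
apply: cexp_le => // t; rewrite /atom_weight cexpD.
have e1 : cexp (iota 0 N) (fun y => (agree r y t)%:R * (A t * (M r)%:R * K) `^ p) x0 =
    (A t * (M r)%:R * K) `^ p / (M r)%:R.
  by rewrite -(cexp_agree _ m_ge2 t x0 rN) -cexpZ; apply: eq_cexp_in => y _; rewrite mulrC.
rewrite e1 cexpZ.
have e2 := cexp_off_weight m_ge2 m_le p_gt0 p_lt t x0 rN.
apply: (@le_trans _ _ ((M r)%:R `^ (1 - p) * ((A t * (M r)%:R * K) `^ p / (M r)%:R +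
  (A t / (M r)%:R * H) `^ p * off_const b p))).
  by rewrite ler_wpM2l ?powR_ge0 // lerD2l ler_wpM2l ?powR_ge0.
have i0 : 0 <= (M r)%:R^-1 :> R by rewrite invr_ge0 ltW.
rewrite !powRM ?mulr_ge0 ?A0 ?(ltW Mr) //.
have -> : (M r)%:R^-1 `^ p = (M r)%:R `^ (- p) :> R.
  by rewrite -powR_inv1 ?ltW // -powRrM mulN1r.
have f1 : (M r)%:R `^ (1 - p) * (M r)%:R `^ p / (M r)%:R = 1 :> R.
  rewrite -powRD ?(gt_eqF Mr) ?implybT // subrK powRr1 ?ltW // divff // gt_eqF //.
have f2 : (M r)%:R `^ (1 - p) * (M r)%:R `^ (- p) = (M r)%:R `^ (1 - 2 * p) :> R.
  by rewrite -powRD ?(gt_eqF Mr) ?implybT //; congr (_ `^ _); ring.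
rewrite -f2 mulrDr mulrDl; apply: lerD; last by rewrite le_eqVlt; apply/orP; left; apply/eqP; ring.
rewrite [leLHS](_ : _ = (M r)%:R `^ (1 - p) * (M r)%:R `^ p / (M r)%:R * (K `^ p * A t `^ p)).
  by rewrite f1 mul1r.
by ring.
Qed.

End AtomPower.

(** * Principal cylinders and atoms *)

Section PrincipalAtoms.
Variables (R : realType) (m : nat -> nat) (b : nat).
Hypothesis m_ge2 : forall k, (2 <= m k)%N.
Hypothesis m_le : forall k, (m k <= b)%N.
Local Notation C := R[i].
Local Notation G := (vilenkin m).
Local Notation M := (gen_num m).
Local Notation normc := (@Normc.normc R).
Variable f : nat -> G -> C.
Hypothesis f_level : forall k, level k (f k).
Hypothesis f_avg : forall k x, avg k (f k.+1) x = f k x.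
Implicit Types (x y t u : G).

(** Predictable: it depends on [k] coordinates only, yet bounds [f k.+1]. Thus ownership at level
    [k] factors out of the average of [f k.+1 - f k], and the increment on which an atom ends is
    still controlled. *)
Definition next_max (k : nat) x : R :=
  \big[Num.max/0]_(z : 'Z_(m k)) normc (f k.+1 (upd x z)).

(* The level at which the principal cylinder currently containing x starts,
   and the value of [next_max] there; a cylinder is principal when [next_max]
   has more than doubled since its predecessor. *)
Fixpoint owner (k : nat) x : nat * R :=
  if k is k'.+1 then
    if 2 * (owner k' x).2 < next_max k x then (k, next_max k x) else owner k' x
  else (0%N, next_max 0 x).

(** The owner at level [r] starts at [r] exactly on principal cylinders; the value 0 elsewhere turns
    sums over principal cylinders of level [r] into averages. *)
Definition height (r : nat) x : R := if (owner r x).1 == r then next_max r x else 0.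

(** All functions a_P with P of level [r] in one, their supports being disjoint. Each increment goes
    to the cylinder that owns it, and [f 0] to the whole group. *)
Definition atom (r J : nat) x : C := (r == 0%N)%:R * f 0 x +
  \sum_(k < J) ((owner k x).1 == r)%:R * (f k.+1 x - f k x).

Lemma next_max_ge k x (z : 'Z_(m k)) : normc (f k.+1 (upd x z)) <= next_max k x.
Proof. exact: (le_bigmax _ (fun z => normc (f k.+1 (upd x z))) z). Qed.

Lemma next_max_ge_succ k x : normc (f k.+1 x) <= next_max k x.
Proof. by have := next_max_ge x (x k); rewrite upd_id. Qed.

Lemma next_max_ge0 k x : 0 <= next_max k x.
Proof. by apply: le_trans (next_max_ge_succ k x); exact: normc_ge0. Qed.

Lemma next_max_ge_cur k x : normc (f k x) <= next_max k x.
Proof.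
rewrite -f_avg; apply: le_trans (normc_cexp m_ge2 [:: k] _ _) _.
have := @cexp_cst m R m_ge2 [:: k] (next_max k x) x; rewrite /= => <-.
rewrite /= /avg ler_pM2l ?invr_gt0 ?mk_gt0 //; apply: ler_sum => z _.
exact: next_max_ge.
Qed.

Lemma next_max_attained k x : exists z : 'Z_(m k),
  normc (f k.+1 (upd x z)) = next_max k x.
Proof.
have z0 : 'Z_(m k) := x k.
have [z _ zE] := @eq_bigmax _ R _ 0 z0 xpredT (fun z => normc (f k.+1 (upd x z)))
  isT (fun z _ => normc_ge0 _).
by exists z.
Qed.

Lemma level_next_max k : level k (next_max k).
Proof.
move=> x y xy; apply: eq_bigr => z _; congr normc; apply: f_level => j.
rewrite ltnS leq_eqVlt => /orP[/eqP->|jk]; first by rewrite !upd_in.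
by rewrite !upd_out ?xy // neq_ltn jk.
Qed.

Lemma level_owner k : level k (owner k).
Proof.
elim: k => [|k IH] x y xy /=; first by rewrite (level_next_max xy).
rewrite (IH x y) => [|j jk]; last by rewrite xy // ltnW.
by rewrite (level_next_max xy).
Qed.

Lemma level_height k : level k (height k).
Proof. by move=> x y xy; rewrite /height (level_owner xy) (level_next_max xy). Qed.

Lemma owner_le k x : ((owner k x).1 <= k)%N.
Proof. by elim: k => //= k IH; case: ifP => // _; exact: leqW. Qed.

Lemma owner_max k x : (owner k x).2 = next_max (owner k x).1 x.
Proof. by elim: k => //= k IH; case: ifP. Qed.

Lemma next_max_le_owner k x : next_max k x <= 2 * (owner k x).2.
Proof.
case: k => [|k] /=; first by have := next_max_ge0 0 x; lra.
case: ltP => //= _; have := next_max_ge0 k.+1 x; lra.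
Qed.

Lemma owner_ge0 k x : 0 <= (owner k x).2.
Proof. by rewrite owner_max next_max_ge0. Qed.

Lemma height_ge0 r x : 0 <= height r x.
Proof. by rewrite /height; case: ifP => // _; exact: next_max_ge0. Qed.

Lemma ownerS k x : (owner k.+1 x).1 = k.+1 \/ owner k.+1 x = owner k x.
Proof. by rewrite /=; case: ifP => _; [left|right]. Qed.

Lemma owner_neq r k x : (r <= k)%N -> (owner r x).1 != r -> (owner k x).1 != r.
Proof.
move=> rk nr; elim: k rk => [|k IH]; first by rewrite leqn0 => /eqP <-.
rewrite leq_eqVlt => /orP[/eqP <- //|rk].
have [->|->] := ownerS k x; last exact: IH.
by rewrite neq_ltn rk orbT.
Qed.

Lemma sum_atoms J x : (0 < J)%N -> \sum_(r < J) atom r J x = f J x.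
Proof.
case: J => // J _; rewrite big_split /= exchange_big /=.
rewrite big_ord_recl /= mul1r big1 ?addr0; last by move=> r _; rewrite mul0r.
rewrite (eq_bigr (fun k : 'I_J.+1 => f k.+1 x - f k x)); last first.
  move=> k _; have kJ : ((owner k x).1 < J.+1)%N.
    by apply: leq_ltn_trans (owner_le k x) _.
  rewrite -mulr_suml (bigD1 (Ordinal kJ)) //= eqxx big1 ?addr0 ?mul1r // => r rk.
  case: eqP => // e; case/eqP: rk; exact/val_inj.
rewrite -(big_mkord xpredT (fun k => f k.+1 x - f k x)) telescope_sumr //.
by rewrite addrC subrK.
Qed.

(** Level [r] owns no increment with [k < r]. For [k >= r] the ownership factor does not involve the
    coordinate [k], over which the increment averages to 0. *)
Lemma cexp_atom0 r d t : (0 < r)%N -> cexp (iota r d) (atom r (r + d)) t = 0.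
Proof.
move=> r0; rewrite (eq_cexp _ (H := fun x => \sum_(k < r + d)
    ((owner k x).1 == r)%:R * (f k.+1 x - f k x))); last first.
  by move=> x; rewrite /atom eqn0Ngt r0 mul0r add0r.
rewrite cexp_sum big1 // => -[k /= krd] _; have [kr|rk] := ltnP k r.
  rewrite -[RHS](cexp_cst m_ge2 (iota r d) (0 : C) t); congr (cexp _ _ _).
  apply/funext => x; rewrite (_ : (_ == r) = false) ?mul0r //.
  by apply/negbTE; rewrite neq_ltn (leq_ltn_trans (owner_le k x)).
have kd : (k - r <= d)%N by rewrite leq_subLR ltnW.
rewrite (cexp_split _ _ kd) subnKC //.
rewrite (_ : (d - (k - r) = (d - (k - r)).-1.+1)%N); last first.
  by rewrite prednK // subn_gt0 ltn_subLR.
rewrite -[RHS](cexp_cst m_ge2 (iota r (k - r)) (0 : C) t); congr (cexp _ _ _).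
apply/funext => x /=.
have lo : level k (fun x => ((owner k x).1 == r)%:R : C).
  exact: (level_comp (fun o => (o.1 == r)%:R) (@level_owner k)).
have lf : level k.+1 (fun x => f k.+1 x - f k x).
  apply: (level_comp2 (fun u v : C => u - v)) => //.
  exact: level_le (leqnSn k) (@f_level k).
rewrite (_ : cexp _ _ = fun x => ((owner k x).1 == r)%:R * (f k.+1 x - f k x)).
  rewrite avg_pull; last exact: level_free lo.
  rewrite (_ : avg k _ x = 0) ?mulr0 //.
  have -> : avg k (fun y => f k.+1 y - f k y) x = avg k (f k.+1) x - avg k (f k) x.
    by rewrite /avg -mulrBr -sumrB.
  rewrite f_avg (@avg_free _ _ m_ge2 k (f k)) ?subrr //.
  exact: level_free (@f_level k).
apply/funext => y; apply: cexp_level => //.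
by apply: (level_comp2 (fun u v : C => u * v)) lf; exact: level_le (leqnSn k) lo.
Qed.

(** As long as level [r] owns the point, the atom telescopes to a value of [f] minus [f r] (minus
    nothing if [r = 0]). The former is at most twice the height since the maximum has not yet more
    than doubled, the latter at most once. *)
Lemma normc_atom_le r J x : (r < J)%N -> normc (atom r J x) <= 3 * height r x.
Proof.
move=> rJ; rewrite /height; case: eqP => [or|/eqP or]; last first.
  have r0 : (0 < r)%N by case: r or {rJ} => //; rewrite eqxx.
  rewrite mulr0 /atom eqn0Ngt r0 mul0r add0r big1 ?Normc.normc0 // => k _.
  have [kr|rk] := ltnP k r; last by rewrite (negbTE (owner_neq rk or)) mul0r.
  rewrite (_ : (_ == r) = false) ?mul0r //.
  by apply/negbTE; rewrite neq_ltn (leq_ltn_trans (owner_le k x)).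
have lr0 := next_max_ge0 r x.
pose base : C := (0 < r)%N%:R * f r x.
have nbase : normc base <= next_max r x.
  rewrite /base; case: (0 < r)%N; rewrite ?mul1r ?mul0r ?Normc.normc0 //.
  exact: next_max_ge_cur.
have stop k : (owner k x).1 = r -> normc (f k.+1 x - base) <= 3 * next_max r x.
  move=> ok; apply: le_trans (le_normcD _ _) _; rewrite normcN.
  have := next_max_ge_succ k x; have := next_max_le_owner k x.
  rewrite owner_max ok; lra.
(* Invariant: either the last increment was owned and the telescoped form holds, or ownership was
   lost, the atom is frozen and only its bound is kept. *)
suff : (owner J.-1 x).1 = r /\ atom r J x = f J x - base \/
    (owner J.-1 x).1 != r /\ normc (atom r J x) <= 3 * next_max r x.
  by case: J rJ => // J _ [[oJ ->]|[_ //]]; exact: stop.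
elim: J rJ => // J IH; rewrite ltnS leq_eqVlt => /orP[/eqP rJ|rJ].
- left; split; first by rewrite -rJ.
  rewrite /atom big_ord_recr big1 /=; last first.
    move=> k _; rewrite (_ : (_ == r) = false) ?mul0r //.
    by apply/negbTE; rewrite neq_ltn (leq_ltn_trans (owner_le k x)) // rJ.
  rewrite -rJ or eqxx mul1r add0r /base.
  by case: r {IH rJ or lr0 nbase stop base} => [|r] /=; rewrite ?mul1r ?mul0r; ring.
- have atomS : atom r J.+1 x = atom r J x +
      ((owner J x).1 == r)%:R * (f J.+1 x - f J x).
    by rewrite /atom big_ord_recr /= addrA.
  have oJ : (owner J x).1 == r -> (owner J.-1 x).1 = r.
    case: J rJ {IH atomS} => // J rJ /eqP.
    have [->|->] := ownerS J x; last by [].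
    by move=> e; move: rJ; rewrite e ltnn.
  have [oJr|oJr] := boolP ((owner J x).1 == r).
    left; split; first exact/eqP.
    have [[_ e]|[/eqP]] := IH rJ; last by rewrite oJ.
    by rewrite atomS oJr mul1r e; ring.
  right; split => //; rewrite atomS (negbTE oJr) mul0r addr0.
  case: (IH rJ) => [[ow ->]|[_ //]].
  by case: J {IH atomS oJ oJr} rJ ow => // J _ ow; exact: stop.
Qed.

Definition partial_max (J : nat) x : R := \big[Num.max/0]_(k < J.+1) normc (f k x).

Lemma partial_max_ge J k x : (k <= J)%N -> normc (f k x) <= partial_max J x.
Proof.
rewrite -ltnS => kJ.
exact: (le_bigmax _ (fun k : 'I_J.+1 => normc (f k x)) (Ordinal kJ)).
Qed.

Lemma partial_max_ge0 J x : 0 <= partial_max J x.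
Proof. by apply: le_trans (partial_max_ge x (leq0n J)); exact: normc_ge0. Qed.

Lemma le_partial_max J x : partial_max J x <= partial_max J.+1 x.
Proof.
apply: bigmax_le => [|k _]; first exact: partial_max_ge0.
by apply: partial_max_ge; rewrite ltnW.
Qed.

Section Powers.
Variable p : R.
Hypothesis p_gt0 : 0 < p.

(** The height may exceed the maximal function at [x]. Restricted to children where [next_max] is
    attained it does not. *)
Definition top_height r x : R :=
  height r x `^ p * (normc (f r.+1 x) == next_max r x)%:R.

(** At least one of the at most [b] children attains the maximum, so the restriction loses at most a
    factor [b] in mean. *)
Lemma cexp_height_le r J x : (r < J)%N ->
  cexp (iota 0 r) (fun y => height r y `^ p) x <=
  b%:R * cexp (iota 0 J) (top_height r) x.
Proof.
move=> rJ.
have ltop : level r.+1 (top_height r).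
  move=> y z yz; have yz' k : (k < r)%N -> y k = z k by move=> kr; exact/yz/ltnW.
  by rewrite /top_height (level_height yz') (level_next_max yz') (f_level yz).
rewrite (cexp_split _ _ rJ) (@eq_cexp _ _ (iota 0 r.+1) _ (top_height r)); last first.
  by move=> y; exact: cexp_level.
rewrite -addn1 iotaD cexp_cat -cexpZ; apply: cexp_le => // y /=.
have -> : avg r (top_height r) y = height r y `^ p *
    avg r (fun z => (normc (f r.+1 z) == next_max r z)%:R) y.
  rewrite -(@avg_pull _ _ r _ (fun z => height r z `^ p)) // => z w.
  by congr (_ `^ _); exact: (level_free (leqnn r) (@level_height r)).
rewrite mulrCA ler_peMr ?powR_ge0 //.
have [z zE] := next_max_attained r y.
have mr := mk_gt0 R m_ge2 r.
rewrite /avg mulrA (@le_trans _ _ (b%:R / (m r)%:R)) //.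
  by rewrite ler_pdivlMr // mul1r ler_nat.
rewrite ler_peMr ?divr_ge0 ?(ltW mr) // (bigD1 z) //= zE.
rewrite (level_free (leqnn r) (@level_next_max r)) eqxx lerDl.
by apply: sumr_ge0.
Qed.

Lemma sum_top_height_le J x :
  \sum_(r < J) top_height r x <= (1 - 2 `^ (- p))^-1 * partial_max J x `^ p.
Proof.
have /andP[q0 q1] : 0 <= (2 : R) `^ (- p) < 1 by apply: powR2_lt1; rewrite oppr_lt0.
set q := 2 `^ (- p) in q0 q1 *; pose kap : R := (1 - q)^-1.
have kap0 : 0 < kap by rewrite invr_gt0 subr_gt0.
have kapE : kap * q + 1 = kap.
  by rewrite /kap; field; rewrite gt_eqF // subr_gt0.
have kap1 : 1 <= kap by rewrite -kapE lerDr mulr_ge0 // ltW.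
(* The owner's height gives the halving at each jump, the running maximum gives the final bound; the
   induction needs their minimum. At a jump attained by [x] the minimum is the new height, and [kap]
   is the fixed point of [kap * q + 1]. At a jump not attained there is no new term and the minimum
   only grows. *)
pose cap k := Num.min (owner k x).2 (partial_max k.+1 x).
have cap0 k : 0 <= cap k by rewrite le_min owner_ge0 partial_max_ge0.
have powR_mono (u v : R) : 0 <= u -> u <= v -> u `^ p <= v `^ p.
  move=> u0 uv; apply: ge0_ler_powR; rewrite ?nnegrE ?(ltW p_gt0) //.
  exact: le_trans uv.
suff key k : \sum_(r < k.+1) top_height r x <= kap * cap k `^ p.
  case: J => [|J]; first by rewrite big_ord0 mulr_ge0 ?powR_ge0 // ltW.
  apply: le_trans (key J) _; rewrite ler_pM2l //; apply: powR_mono => //.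
  by rewrite /cap ge_min lexx orbT.
elim: k => [|k IH].
  rewrite big_ord_recl big_ord0 addr0 /top_height /height /=.
  case: eqP => [fE|_]; last by rewrite mulr0 mulr_ge0 ?powR_ge0 // ltW.
  rewrite mulr1 -[leLHS]mul1r ler_pM ?powR_ge0 //; apply: powR_mono.
    exact: next_max_ge0.
  by rewrite /cap /= le_min lexx -fE partial_max_ge.
rewrite big_ord_recr /=; apply: le_trans (lerD IH (lexx _)) _.
rewrite /top_height /height.
have capS : (owner k x).2 <= (owner k.+1 x).2 -> cap k <= cap k.+1.
  move=> ok; rewrite /cap le_min !ge_min ok /=.
  by rewrite le_partial_max orbT.
have [jump|nojump] := ltP (2 * (owner k x).2) (next_max k.+1 x); last first.
  have oE : owner k.+1 x = owner k x by rewrite /= ltNge nojump.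
  rewrite oE (_ : (_ == k.+1) = false); last first.
    by apply/negbTE; rewrite neq_ltn ltnS owner_le.
  rewrite powR0 ?(gt_eqF p_gt0) // mul0r addr0 ler_pM2l //.
  by apply: powR_mono => //; apply: capS; rewrite oE.
have oE : owner k.+1 x = (k.+1, next_max k.+1 x) by rewrite /= jump.
have o0 := owner_ge0 k x.
have capk : cap k <= cap k.+1 by apply: capS; rewrite oE /=; lra.
rewrite oE eqxx /=; case: eqP => [fE|_]; last first.
  by rewrite mulr0 addr0 ler_pM2l //; exact: powR_mono.
have -> : cap k.+1 = next_max k.+1 x.
  by rewrite /cap oE /=; apply/min_idPl; rewrite -fE partial_max_ge.
rewrite mulr1 -[in leRHS]kapE mulrDl mul1r lerD2r -mulrA ler_pM2l //.
have cap_half : cap k <= 2^-1 * next_max k.+1 x.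
  by rewrite /cap ge_min; apply/orP; left; lra.
apply: le_trans (powR_mono _ _ (cap0 k) cap_half) _.
rewrite powRM ?invr_ge0 ?next_max_ge0 // -powR_inv1 // -powRrM mulN1r //.
Qed.

End Powers.

End PrincipalAtoms.

(** * Logarithms and series *)

Section Series.
Variable R : realType.
Implicit Types (x e dl : R).

Lemma ln_le_powR e x : 0 < e -> 1 <= x -> ln x <= x `^ e / e.
Proof.
move=> e0 x1; rewrite ler_pdivlMr // mulrC -ln_powR.
by apply/ltW/ln_sublinear/powR_gt0; exact: lt_le_trans x1.
Qed.

Lemma lnS_le n : (0 < n)%N -> ln n.+1%:R <= ln n%:R + n%:R^-1 :> R.
Proof.
move=> n0; have nR : 0 < n%:R :> R by rewrite ltr0n.
have -> : n.+1%:R = n%:R * (1 + n%:R^-1) :> R.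
  by rewrite mulrDr mulr1 divff ?gt_eqF // -natr1.
rewrite lnM ?posrE ?addr_gt0 ?invr_gt0 // lerD2l le_ln1Dx //.
by rewrite (lt_le_trans _ (_ : 0 <= _)) ?invr_ge0 ?ltrN10 // ltW.
Qed.

Lemma lnS_ge n : (0 < n)%N -> ln n%:R + n.+1%:R^-1 <= ln n.+1%:R :> R.
Proof.
move=> n0; have nR : 0 < n%:R :> R by rewrite ltr0n.
have SR : 0 < n.+1%:R :> R by rewrite ltr0n.
have nE : n%:R = n.+1%:R * (1 - n.+1%:R^-1) :> R.
  by rewrite mulrBr mulr1 divff ?gt_eqF // -natr1 addrK.
have u0 : 0 < 1 - n.+1%:R^-1 :> R by rewrite -(pmulr_rgt0 _ SR) -nE.
rewrite [in leLHS]nE lnM ?posrE // -addrA gerDl.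
rewrite -lerBrDr sub0r; apply: le_ln1Dx.
by rewrite ltrN2 invf_lt1 // ltr1n.
Qed.

Lemma riesz_logS n : riesz_log R n.+1 = riesz_log R n + n.+1%:R^-1.
Proof. by rewrite /riesz_log big_nat_recr. Qed.

Lemma riesz_log_le n : (0 < n)%N -> riesz_log R n <= 1 + ln n%:R.
Proof.
elim: n => // -[|n] IH _.
  by rewrite /riesz_log big_nat1 invr1 ln1 addr0.
rewrite riesz_logS (le_trans (lerD (IH isT) (lexx _))) // -addrA lerD2l.
exact: lnS_ge.
Qed.

Lemma ln_le_riesz_log n : ln n.+1%:R <= riesz_log R n.
Proof.
elim: n => [|n IH]; first by rewrite ln1 riesz_log_ge0.
by rewrite riesz_logS (le_trans (lnS_le _)) // lerD2r.
Qed.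

Lemma riesz_log_le_powR e n : 0 < e -> riesz_log R n <= (1 + e^-1) * n%:R `^ e.
Proof.
move=> e0; have c0 : 0 <= 1 + e^-1 by rewrite addr_ge0 // invr_ge0 ltW.
have [->|n0] := posnP n.
  by rewrite /riesz_log big_geq // mulr_ge0 ?powR_ge0.
have n1 : 1 <= n%:R :> R by rewrite ler1n.
rewrite (le_trans (riesz_log_le n0)) // mulrDl mul1r lerD //.
  by rewrite -[leLHS](powRr0 n%:R) ler_powR // ltW.
by rewrite mulrC ln_le_powR.
Qed.

Lemma trunc_log_le_powR e n : 0 < e -> (0 < n)%N ->
  (trunc_log 2 n).+2%:R <= (2 + (e * ln 2)^-1) * n%:R `^ e.
Proof.
move=> e0 n0; have n1 : 1 <= n%:R :> R by rewrite ler1n.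
have ln20 : 0 < ln 2 :> R by rewrite ln_gt0 // ltr1n.
rewrite -addn2 addnC natrD mulrDl lerD //.
  by rewrite ler_peMr // -[leLHS](powRr0 n%:R) ler_powR // ltW.
rewrite invfM mulrAC ler_pdivlMr // [leRHS]mulrC.
apply: le_trans _ (ln_le_powR e0 n1).
rewrite mulr_natl -lnXn ?ltr0n // ler_ln ?posrE ?exprn_gt0 ?ltr0n //.
by rewrite -natrX ler_nat trunc_logP.
Qed.

(** With [u = n / n.+1], the ratio [n^-dl / n.+1^-dl = exp (- dl * ln u)] is at least
    [1 + dl / n.+1]: a discrete comparison with an integral. *)
Lemma powR_telescope dl n : 0 < dl -> (0 < n)%N ->
  n.+1%:R `^ (- 1 - dl) <= dl^-1 * (n%:R `^ (- dl) - n.+1%:R `^ (- dl)).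
Proof.
move=> dl0 n0; have nR : 0 < n%:R :> R by rewrite ltr0n.
have SR : 0 < n.+1%:R :> R by rewrite ltr0n.
have nE : n%:R = n.+1%:R * (1 - n.+1%:R^-1) :> R.
  by rewrite mulrBr mulr1 divff ?gt_eqF // -natr1 addrK.
have u0 : 0 < 1 - n.+1%:R^-1 :> R by rewrite -(pmulr_rgt0 _ SR) -nE.
have lnu : ln (1 + - n.+1%:R^-1) <= - n.+1%:R^-1 :> R.
  by apply: le_ln1Dx; rewrite ltrN2 invf_lt1 // ltr1n.
rewrite mulrC ler_pdivlMr // nE powRM ?(ltW SR) ?(ltW u0) //.
rewrite addrC powRD ?(gt_eqF SR) ?implybT // powR_inv1 ?(ltW SR) //.
rewrite -[X in _ - X]mulr1 -mulrBr -mulrA ler_pM2l ?powR_gt0 // lerBrDr.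
rewrite [in leRHS]/powR gt_eqF //; apply: le_trans (expR_ge1Dx _).
rewrite [leLHS]addrC lerD2l mulNr -mulrN [leLHS]mulrC ler_pM2l //.
by rewrite lerNr.
Qed.

Lemma series_tail_le dl a N : 0 < dl -> (0 < a)%N ->
  \sum_(a <= n < N) n%:R `^ (- 1 - dl) <= (1 + dl^-1) * a%:R `^ (- dl).
Proof.
move=> dl0 a0; have d0 : 0 < dl^-1 by rewrite invr_gt0.
have [Na|aN] := leqP N a.
  by rewrite big_geq // mulr_ge0 ?powR_ge0 // addr_ge0 // ltW.
suff key d : \sum_(a <= n < (a + d).+1) n%:R `^ (- 1 - dl) <=
    (1 + dl^-1) * a%:R `^ (- dl) - dl^-1 * (a + d)%:R `^ (- dl).
  have := key (N.-1 - a)%N; rewrite subnKC; last by rewrite -ltnS (ltn_predK aN).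
  rewrite (ltn_predK aN) => /le_trans -> //.
  by rewrite gerBl mulr_ge0 ?powR_ge0 // ltW.
elim: d => [|d IH].
  rewrite addn0 big_nat1 mulrDl mul1r addrK powRD; last first.
    by apply/implyP => _; rewrite gt_eqF ?ltr0n.
  rewrite ler_piMl ?powR_ge0 // powR_inv1 // invf_le1 ?ler1n ?ltr0n //.
rewrite addnS big_nat_recr /=; last by rewrite ltnW // ltnS leq_addr.
apply: le_trans (lerD IH (powR_telescope _ _)) _ => //.
  by rewrite addn_gt0 a0.
by rewrite mulrBr addrA subrK.
Qed.

End Series.

(** * The inequality at a finite level *)

Section FiniteInequality.
Variables (R : realType) (m : nat -> nat) (b : nat) (p : R).
Hypothesis m_ge2 : forall k, (2 <= m k)%N.
Hypothesis m_le : forall k, (m k <= b)%N.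
Hypothesis p_gt0 : 0 < p.
Hypothesis p_lt : 2 * p < 1.
Local Notation C := R[i].
Local Notation G := (vilenkin m).
Local Notation M := (gen_num m).
Local Notation normc := (@Normc.normc R).
Implicit Types (x y t u : G).

(** The diagonal factor [b * (J + 1) * l_n] for [J = trunc_log 2 n + 1], which satisfies both
    [n <= 2^J <= M J] and [J <= n]. *)
Definition diag_factor (n : nat) : R :=
  b%:R * (trunc_log 2 n).+2%:R * riesz_log R n.

Lemma diag_factor_ge0 n : 0 <= diag_factor n.
Proof. by rewrite !mulr_ge0 // riesz_log_ge0. Qed.

(** [dl] is half the gap, so [2 - 2 * p = 1 + 2 * dl]. With the exponent [e] the two logarithms on
    the diagonal, to the power p, cost [n^dl]; with [dl / p] the single one off it costs
    [(n / a)^dl]. The last factor comes from the tail of the series of [n^(- 1 - dl)]. *)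
Definition weight_const : R :=
  let dl := (1 - 2 * p) / 2 in
  let e := dl / (2 * p) in
  ((b%:R * (2 + (e * ln 2)^-1) * (1 + e^-1)) `^ p +
   off_const b p * (1 + (dl / p)^-1) `^ p) * (1 + dl^-1).

Lemma off_const_ge0 : 0 <= off_const b p.
Proof.
have p1 : p - 1 < 0 by have := p_lt; have := p_gt0; lra.
have p2 : 2 * p - 1 < 0 by have := p_lt; lra.
rewrite /off_const !mulr_ge0 ?powR_ge0 // invr_ge0 subr_ge0 ltW //.
  by case/andP: (powR2_lt1 p2).
by case/andP: (powR2_lt1 p1).
Qed.

(** Each term is at most a constant times [a^dl * n^(- 1 - dl)], and the tail from [a] on returns
    [a^(- dl)]. The bound is therefore independent of [a], which will be [M r]. *)
Lemma weighted_series_le a N : (0 < a)%N ->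
  \sum_(1 <= n < N | (a <= n)%N) (n%:R `^ (2 - 2 * p))^-1 *
    (diag_factor n `^ p +
     off_const b p * a%:R `^ (1 - 2 * p) * riesz_log R (n %/ a) `^ p)
  <= weight_const.
Proof.
move=> a0; rewrite /weight_const.
set dl := (1 - 2 * p) / 2; set e := dl / (2 * p).
have dl0 : 0 < dl by rewrite divr_gt0 // subr_gt0.
have e0 : 0 < e by rewrite divr_gt0 // mulr_gt0.
have dp0 : 0 < dl / p by rewrite divr_gt0.
have e2p : e * p + e * p = dl by rewrite /e; field; rewrite gt_eqF.
have dpp : dl / p * p = dl by rewrite divfK // gt_eqF.
have dl2 : 1 - 2 * p = dl + dl by rewrite /dl; field.
have w2 : 2 - 2 * p = 1 + dl + dl by rewrite -[RHS]addrA -dl2; ring.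
have oc0 := off_const_ge0.
have ln20 : 0 < ln 2 :> R by rewrite ln_gt0 // ltr1n.
clearbody dl e.
set c1 := b%:R * _ * _; set c2 := 1 + (dl / p)^-1.
have c10 : 0 <= c1.
  have i0 : 0 <= (e * ln 2)^-1 by rewrite invr_ge0 mulr_ge0 // ltW.
  have i1 : 0 <= e^-1 by rewrite invr_ge0 ltW.
  by apply: mulr_ge0; [apply: mulr_ge0 => //|]; exact: addr_ge0.
have c20 : 0 <= c2 by rewrite /c2 addr_ge0 // invr_ge0 ltW.
set c := c1 `^ p + off_const b p * c2 `^ p.
have cc0 : 0 <= c.
  by apply: addr_ge0; [exact: powR_ge0|apply: mulr_ge0 => //; exact: powR_ge0].
have aR : 1 <= a%:R :> R by rewrite ler1n.
have powR_mono (u v : R) : 0 <= u -> u <= v -> u `^ p <= v `^ p.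
  move=> u0 uv; apply: ge0_ler_powR; rewrite ?nnegrE ?(ltW p_gt0) //.
  exact: le_trans uv.
have term n : (a <= n)%N -> (n%:R `^ (2 - 2 * p))^-1 *
    (diag_factor n `^ p + off_const b p * a%:R `^ (1 - 2 * p) *
      riesz_log R (n %/ a) `^ p) <= c * a%:R `^ dl * n%:R `^ (- 1 - dl).
  move=> an; have n0 : (0 < n)%N by exact: leq_trans an.
  have nR : 0 < n%:R :> R by rewrite ltr0n.
  have a0R : 0 < a%:R :> R by rewrite ltr0n.
  have nd0 : 0 < n%:R `^ dl by rewrite powR_gt0.
  have wn : (n%:R `^ (2 - 2 * p))^-1 = n%:R `^ (- 1 - dl) / n%:R `^ dl.
    by rewrite -!powRN -powRD ?(gt_eqF nR) ?implybT // w2; congr (_ `^ _); ring.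
  have k1 : diag_factor n `^ p <= c1 `^ p * n%:R `^ dl.
    rewrite -[in X in _ <= _ * X]e2p powRD ?(gt_eqF nR) ?implybT // !(powRrM _ e).
    have -> : c1 `^ p * ((n%:R `^ e) `^ p * (n%:R `^ e) `^ p) =
        (c1 * (n%:R `^ e * n%:R `^ e)) `^ p.
      by rewrite (powRM _ c10) ?mulr_ge0 ?powR_ge0 // powRM ?powR_ge0.
    apply: powR_mono; first exact: diag_factor_ge0.
    rewrite /diag_factor /c1.
    rewrite [leRHS](_ : _ = b%:R * ((2 + (e * ln 2)^-1) * n%:R `^ e) *
      ((1 + e^-1) * n%:R `^ e)); last by ring.
    apply: ler_pM; rewrite ?mulr_ge0 ?riesz_log_ge0 ?riesz_log_le_powR //.
    by rewrite ler_wpM2l // trunc_log_le_powR.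
  have k2 : a%:R `^ (1 - 2 * p) * riesz_log R (n %/ a) `^ p <=
      c2 `^ p * (a%:R `^ dl * n%:R `^ dl).
    have -> : n%:R `^ dl = a%:R `^ dl * (n%:R / a%:R) `^ dl.
      by rewrite -powRM ?divr_ge0 // mulrC divfK // gt_eqF.
    rewrite dl2 powRD ?(gt_eqF a0R) ?implybT // mulrCA -!mulrA ler_pM2l ?powR_gt0 //.
    rewrite mulrCA ler_pM2l ?powR_gt0 //.
    rewrite -{1}dpp powRrM -powRM ?powR_ge0 //.
    apply: powR_mono; first exact: riesz_log_ge0.
    apply: le_trans (riesz_log_le_powR _ dp0) _; apply: ler_wpM2l => //.
    apply: ge0_ler_powR; rewrite ?nnegrE ?(ltW dp0) ?divr_ge0 //.
    by rewrite ler_pdivlMr // -natrM ler_nat leq_divM.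
  rewrite wn [leRHS]mulrC -[leLHS]mulrA ler_pM2l ?powR_gt0 // mulrC ler_pdivrMr //.
  rewrite /c -[leRHS]mulrA [leRHS]mulrDl; apply: lerD.
    apply: le_trans k1 _; rewrite ler_wpM2l ?powR_ge0 // ler_peMl ?powR_ge0 //.
    by rewrite -[leLHS](powRr0 a%:R) ler_powR // ltW.
  by rewrite -[leLHS]mulrA -[leRHS]mulrA ler_wpM2l.
have [Na|aN] := leqP N a.
  have d0 : 0 <= 1 + dl^-1 by rewrite addr_ge0 // invr_ge0 ltW.
  rewrite big_nat_cond big_pred0 => [|n]; first exact: mulr_ge0.
  by apply/negP => /andP[/andP[_ nN] an]; have := leq_trans nN (leq_trans Na an); rewrite ltnn.
rewrite big_mkcond (big_cat_nat (n := a)) ?(ltnW aN) //=.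
rewrite big_nat_cond big1 ?add0r => [|n /andP[/andP[_ na] _]]; last by rewrite leqNgt na.
rewrite (@le_trans _ _ (\sum_(a <= n < N) c * a%:R `^ dl * n%:R `^ (- 1 - dl))) //.
  by rewrite !big_nat; apply: ler_sum => n /andP[an _]; rewrite an term.
rewrite -mulr_sumr -mulrA ler_wpM2l //.
have ad0 : 0 < a%:R `^ dl by rewrite powR_gt0 // ltr0n.
rewrite -ler_pdivlMl // mulrC -powRN; exact: series_tail_le.
Qed.

Section Martingale.
Variable f : nat -> G -> C.
Hypothesis f_level : forall k, level k (f k).
Hypothesis f_avg : forall k x, avg k (f k.+1) x = f k x.

(** Free of [K], it bounds the p-th power of every [l_n S_(M_K) R_n f] at [x], hence that of the
    maximal function. *)
Definition majorant (N n : nat) x0 x : R := \sum_(r < N | (M r <= n)%N)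
  (M r)%:R `^ (1 - p) * cexp (iota 0 r)
    (atom_weight b p (fun t => 3 * height f r t) r (diag_factor n)
      (riesz_log R (n %/ M r)) x) x0.

Lemma majorant_ge0 N n x0 x : 0 <= majorant N n x0 x.
Proof.
apply: sumr_ge0 => r _; rewrite mulr_ge0 ?powR_ge0 //; apply: cexp_ge0 => // t.
exact: atom_weight_ge0.
Qed.

Lemma level_majorant N n x0 : level N (majorant N n x0).
Proof.
move=> x y xy; apply: eq_bigr => r _; congr (_ * _); apply: eq_cexp_in => t _.
rewrite /atom_weight; congr (_ * _ + _ * _).
  rewrite (@level_agree m r t x y) // => k kr; apply: xy; exact: ltn_trans kr _.
apply: eq_bigr => s _; apply: eq_bigr => l _; congr (_ * _).
rewrite (@level_almost_agree m s l t x y) // => k kl; apply: xy.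
by apply: leq_trans kl (leq_trans _ (ltnW (ltn_ord r))); rewrite -ltnS.
Qed.

Lemma powR_le_majorant N n K x0 x : (0 < n)%N -> (n <= N)%N ->
  normc (cexp (iota 0 N) (fun u => f N u * riesz_kernel R n (M K) (x - u)) x0) `^ p
  <= majorant N n x0 x.
Proof.
move=> n0 nN; have N0 : (0 < N)%N by exact: leq_trans nN.
have p01 : 0 < p <= 1 by apply/andP; split => //; have := p_lt; have := p_gt0; lra.
pose g r := cexp (iota 0 N) (fun u => atom f r N u * riesz_kernel R n (M K) (x - u)) x0.
have -> : cexp (iota 0 N) (fun u => f N u * riesz_kernel R n (M K) (x - u)) x0 =
    \sum_(r < N) g r.
  rewrite /g -cexp_sum; congr (cexp _ _ _); apply/funext => u.
  by rewrite -mulr_suml sum_atoms.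
have g0 (r : 'I_N) : ~~ (M r <= n)%N -> g r = 0.
  (* [M 0 = 1 <= n], so a discarded level is positive; its atom has mean zero on cylinders where the
     kernel is constant. *)
  rewrite -ltnNge => nr; have r0 : (0 < r)%N.
    by case: posnP nr => // ->; rewrite ltnS leqNgt n0.
  have rN : (r + (N - r) = N)%N by rewrite subnKC // ltnW.
  rewrite /g (cexp_split _ _ (ltnW (ltn_ord r))) add0n.
  rewrite -[RHS](cexp_cst m_ge2 (iota 0 r) (0 : C) x0); congr (cexp _ _ _).
  apply/funext => t; apply: cexp_riesz_kernel0 => //; first exact: ltnW.
  by rewrite -[X in atom f r X]rN cexp_atom0.
rewrite (bigID (fun r : 'I_N => (M r <= n)%N)) /= [X in _ + X]big1 ?addr0 //.
apply: le_trans (_ : (\sum_(r < N | (M r <= n)%N) normc (g r)) `^ p <= _).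
  apply: ge0_ler_powR; rewrite ?nnegrE ?normc_ge0 ?(ltW p_gt0) ?normc_sum //.
  by apply: sumr_ge0 => r _; exact: normc_ge0.
apply: le_trans (powR_sum_subadd _ _ p01 _) _; first by move=> r; exact: normc_ge0.
apply: ler_sum => -[r /= rN] _; rewrite /g => {g g0}.
have [d dN] : exists d, N = (r + d)%N by exists (N - r)%N; rewrite subnKC // ltnW.
move: rN nN; rewrite dN => rN nN.
apply: (@atom_pointwise _ _ _ _ m_ge2 m_le p_gt0 p_lt (atom f r (r + d))
  (fun t => 3 * height f r t) r d n (trunc_log 2 n).+1 K x x0).
- by move=> y z yz; rewrite (level_height f_level yz).
- by move=> u; exact: normc_atom_le.
- by move=> r0 t; exact: cexp_atom0.
- apply: leq_trans (gen_num_ge m_ge2 _); apply: ltnW; exact: trunc_log_ltn.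
- apply: leq_trans nN.
  by apply: leq_trans (trunc_logP (isT : (1 < 2)%N) n0); apply: ltn_expl.
Qed.

(** [3^p] comes from the bound on atoms, [b] from passing to the children that attain the maximum,
    the last factor from the geometric growth of heights. *)
Definition main_const : R :=
  3 `^ p * weight_const * (b%:R * (1 - 2 `^ (- p))^-1).

Lemma sum_majorant_le N x0 :
  \sum_(1 <= n < N) (n%:R `^ (2 - 2 * p))^-1 *
    cexp (iota 0 N) (majorant N n x0) x0 <=
  main_const * cexp (iota 0 N) (fun x => partial_max f N x `^ p) x0.
Proof.
have wc0 : 0 <= weight_const.
  have := @weighted_series_le 1 0 isT; rewrite big_geq //.
pose Eh r := cexp (iota 0 r) (fun t => height f r t `^ p) x0.
have Eh0 r : 0 <= Eh r by apply: cexp_ge0 => // t; exact: powR_ge0.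
pose w n r := (n%:R `^ (2 - 2 * p))^-1 * (diag_factor n `^ p +
  off_const b p * (M r)%:R `^ (1 - 2 * p) * riesz_log R (n %/ M r) `^ p).
apply: (@le_trans _ _ (\sum_(1 <= n < N) \sum_(r < N | (M r <= n)%N)
    w n r * (3 `^ p * Eh r))).
  apply: ler_sum => n _; rewrite /majorant cexp_sum mulr_sumr.
  apply: ler_sum => r _; rewrite /w -mulrA ler_wpM2l ?invr_ge0 ?powR_ge0 //.
  have h0 t : 0 <= 3 * height f r t by rewrite mulr_ge0 // height_ge0.
  apply: le_trans (atom_mean m_ge2 m_le p_gt0 p_lt _ (ltnW (ltn_ord r))
    (diag_factor_ge0 n) (riesz_log_ge0 _ _) h0) _.
  rewrite le_eqVlt; apply/orP; left; apply/eqP; congr (_ * _); rewrite /Eh -cexpZ; congr (cexp _ _ _).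
  by apply/funext => t; rewrite powRM // height_ge0.
rewrite (exchange_big_dep xpredT) //=.
apply: (@le_trans _ _ (\sum_(r < N) weight_const * (3 `^ p * Eh r))).
  apply: ler_sum => r _; rewrite -mulr_suml ler_wpM2r ?mulr_ge0 ?powR_ge0 //.
  by apply: weighted_series_le; apply: gen_num_gt0.
rewrite -mulr_sumr -mulr_sumr mulrA /main_const [3 `^ p * _]mulrC -[leRHS]mulrA.
apply: (ler_wpM2l (mulr_ge0 wc0 (powR_ge0 _ _))).
apply: (@le_trans _ _ (\sum_(r < N) b%:R * cexp (iota 0 N) (top_height f p r) x0)).
  by apply: ler_sum => r _; exact: cexp_height_le.
rewrite -mulr_sumr -cexp_sum -mulrA ler_wpM2l // -cexpZ; apply: cexp_le => // x.
exact: sum_top_height_le.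
Qed.

End Martingale.
End FiniteInequality.

(** * Integrals of finite-level functions *)

Section LevelIntegral.
Local Open Scope classical_set_scope.
Variables (R : realType) (m : nat -> nat).
Hypothesis m_ge2 : forall k, (2 <= m k)%N.
Local Notation C := R[i].
Local Notation G := (vilenkin m).
Local Notation M := (gen_num m).
Implicit Types (x y t u : G).

Lemma cylinderE n x : cylinder n x = [set y | agree n y x].
Proof. by apply/seteqP; split => y /agreeP. Qed.

Lemma finite_level_cylinders n : finite_set (level_cylinders m n).
Proof.
elim: n => [|n IH].
  apply: (sub_finite_set _ (finite_set1 (setT : set G))) => _ [x _ <-].
  by apply/seteqP; split.
apply: (@sub_finite_set _ _ [set A `&` [set y : G | y n = z] |
  A in level_cylinders m n & z in [set: 'Z_(m n)]]); last first.
  by apply: finite_image2 => //; exact: finite_finset.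
move=> _ [x _ <-]; exists (cylinder n x); first by exists x.
exists (x n) => //; apply/seteqP; split => y.
  move=> [yx yn] k; rewrite ltnS leq_eqVlt => /orP[/eqP->|]; [exact: yn|exact: yx].
by move=> yx; split => [k kn|]; apply: yx => //; exact: ltnW.
Qed.

Lemma level_set_measurable n (A : set G) :
  (forall x y, (forall k, (k < n)%N -> x k = y k) -> A x -> A y) -> measurable A.
Proof.
move=> lA.
have -> : A = \bigcup_(B in level_cylinders m n `&` [set B | B `<=` A]) B.
  apply/seteqP; split => [x Ax|x [B [_ BA]]]; last exact: BA.
  exists (cylinder n x); last by move=> k.
  split; first by exists x.
  by move=> y yx; apply: lA Ax => k kn; rewrite yx.
apply: fin_bigcup_measurable.
  exact: sub_finite_set (@subIsetl _ _ _) (finite_level_cylinders n).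
by move=> B [[x _ <-] _]; exact: measurable_cylinder.
Qed.

Lemma level_measurable_fun d (T : measurableType d) n (F : G -> T) :
  level n F -> measurable_fun setT F.
Proof.
move=> lF _ Y _; apply: (@level_set_measurable n) => x y xy [_ Yx].
by split => //; rewrite /preimage /= -(lF x y).
Qed.

(** Sets that cannot separate points with equal first [n] coordinates form a sigma-algebra
    containing the cylinders of level [n]. *)
Lemma level_of_sigma T n (g : G -> T) :
  (forall c, <<s level_cylinders m n >> (g @^-1` [set c])) -> level n g.
Proof.
move=> mg x y xy.
pose S : set (set G) := [set A | forall u v, (forall k, (k < n)%N -> u k = v k) -> A u -> A v].
have sS : sigma_algebra setT S.
  split => [//|A SA u v uv|F SF u v uv [i _ Fu]]; last first.
    by exists i => //; exact: SF Fu.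
  rewrite !setTD => nAu Av; apply: nAu; apply: (SA v u) => // k kn.
  by rewrite uv.
have : <<s level_cylinders m n >> `<=` S.
  apply: smallest_sub => // _ [z _ <-] u v uv uz k kn.
  by rewrite -uv // uz.
by move=> /(_ _ (mg (g x))) /(_ x y xy) /= ->.
Qed.

Lemma level_level_measurable n (g : G -> C) : level_measurable n g -> level n g.
Proof.
move=> [mre mim].
have lre : level n (fun x => complex.Re (g x)).
  apply: level_of_sigma => c.
  by have := mre measurableT [set c] (measurable_set1 c); rewrite setTI.
have lim : level n (fun x => complex.Im (g x)).
  apply: level_of_sigma => c.
  by have := mim measurableT [set c] (measurable_set1 c); rewrite setTI.
by move=> x y xy; apply/eqP; rewrite eq_complex (lre _ _ xy) (lim _ _ xy) !eqxx.
Qed.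

Variable mu : probability G R.
Hypothesis mu_haar : haar mu.

Lemma le_prod_cexp s (F : G -> R) x : (forall y, 0 <= F y) ->
  F x <= \prod_(k <- s) (m k)%:R * cexp s F x.
Proof.
move=> F0; elim: s x => [|k s IH] x; first by rewrite big_nil mul1r.
rewrite big_cons /= mulrAC /avg -!mulrA mulVKf ?gt_eqF ?mk_gt0 //.
rewrite mulrC (bigD1 (x k)) //= upd_id mulrDr -[leLHS]addr0 lerD //.
by rewrite mulr_ge0 ?prodr_ge0 // sumr_ge0 // => z _; exact: cexp_ge0.
Qed.

Lemma level_bounded n (F : G -> R) : level n F -> exists B, forall x, `|F x| <= B.
Proof.
move=> lF; exists (\prod_(k <- iota 0 n) (m k)%:R *
  cexp (iota 0 n) (fun y => `|F y|) 0) => x.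
have -> : cexp (iota 0 n) (fun y => `|F y|) 0 = cexp (iota 0 n) (fun y => `|F y|) x.
  apply: (@level_cexp_iota _ _ 0 n) => //.
  exact: (level_comp (fun z : R => `|z|) lF).
exact: (le_prod_cexp (iota 0 n) x (fun y => normr_ge0 (F y))).
Qed.

Lemma level_integrable n (F : G -> R) : level n F ->
  mu.-integrable setT (EFin \o F).
Proof.
move=> lF; apply: measurable_bounded_integrable => //.
- by rewrite (le_lt_trans (probability_le1 _ _)) ?ltry.
- exact: level_measurable_fun lF.
have [B FB] := level_bounded lF.
exists B; split; first exact: num_real.
by move=> c Bc x _; exact: le_trans (FB x) (ltW Bc).
Qed.

Lemma integral_shift n (F : G -> R) a : level n F ->
  (\int[mu]_x (F (a + x))%:E = \int[mu]_x (F x)%:E)%E.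
Proof.
move=> lF; have la : level n (fun x : G => F (a + x)).
  move=> x y xy; apply: lF => k kn.
  by rewrite -[LHS]/(a k + x k) -[RHS]/(a k + y k) xy.
have mF : @measurable_fun _ _ G (\bar R) setT (EFin \o F).
  by apply/measurable_EFinP; exact: level_measurable_fun lF.
have := @integral_pushforward _ _ G G R (fun x => a + x) (@measurable_shift m a) mu
  setT (EFin \o F) mF.
rewrite preimage_setT => /(_ (level_integrable la) measurableT) <-.
by apply: eq_measure_integral => [|? A mA _]; [exact: measurable_shift|exact: mu_haar].
Qed.

Lemma level_integral n (F : G -> R) x : level n F ->
  (\int[mu]_y (F y)%:E = (cexp (iota 0 n) F x)%:E)%E.
Proof.
elim: n F x => [|n IH] F x lF.
  rewrite /= (eq_integral (cst (F x)%:E)) => [|y _]; last by rewrite /= (lF y x).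
  rewrite integral_cst //= -[RHS]mule1; congr (_ * _)%E.
  exact: (probability_setT mu).
rewrite -addn1 iotaD cexp_cat /= -IH; last exact: level_avgS.
pose e (z : 'Z_(m n)) : G := @upd m 0 n z.
(* Changing one coordinate is a translation, so averaging over it is averaging over translates, and
   Haar invariance shows that this leaves the integral unchanged. *)
have ez (z : 'Z_(m n)) y : upd y z = e (z - y n) + y.
  apply: functional_extensionality_dep => j.
  rewrite -[RHS]/(e (z - y n) j + y j) /e; have [->|jn] := eqVneq j n.
    by rewrite !upd_in subrK.
  by rewrite !upd_out // add0r.
have avgE y : avg n F y = (m n)%:R^-1 * \sum_(z : 'Z_(m n)) F (e z + y).
  rewrite /avg; congr (_ * _); rewrite (reindex_inj (@addrI _ (y n))) /=.
  by apply: eq_bigr => z _; rewrite ez [y n + z]addrC addrK.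
have lz z : level n.+1 (fun y : G => F (e z + y)).
  move=> u v uv; apply: lF => k kn.
  by rewrite -[LHS]/(e z k + u k) -[RHS]/(e z k + v k) uv.
under [RHS]eq_integral do rewrite avgE EFinM -sumEFin.
rewrite integralZl //; last first.
  by apply: integrable_sum => // z _; exact: level_integrable (lz z).
rewrite integral_sum //; last by move=> z; exact: level_integrable (lz z).
under eq_bigr do rewrite (integral_shift _ lF).
rewrite sumr_const cardT -cardE card_Zm //.
have [r ->] : exists r, (\int[mu]_x0 (F x0)%:E = r%:E)%E.
  exists (fine (\int[mu]_x0 (F x0)%:E)); rewrite fineK //.
  apply: integrable_fin_num => //; exact: level_integrable lF.
have -> : (r%:E *+ m n = (r *+ m n)%:E)%R by elim: (m n) => // j; rewrite !mulrS EFinD => ->.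
by rewrite -EFinM -[r *+ _]mulr_natl mulKf // gt_eqF ?mk_gt0.
Qed.

End LevelIntegral.

(** * Fourier coefficients of martingales *)

Section Orthonormality.
Variables (R : realType) (m : nat -> nat).
Hypothesis m_ge2 : forall k, (2 <= m k)%N.
Local Notation C := R[i].
Local Notation G := (vilenkin m).
Local Notation M := (gen_num m).
Implicit Types (x y t u : G).

Lemma avg_rademacher k a c x : (a < m k)%N -> (c < m k)%N ->
  avg k (fun y => rademacher R k y ^+ a * (rademacher R k y ^+ c)^*%C) x =
  (a == c)%:R.
Proof.
move=> am cm; pose w : C := zeta R (m k) ^+ a * (zeta R (m k) ^+ c)^*%C.
have prim := zeta_prim_m R m_ge2 k.
have mk0 := mk_gt0 C m_ge2 k.
rewrite /avg (eq_bigr (fun z : 'Z_(m k) => w ^+ z)); last first.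
  move=> z _; rewrite rademacherE upd_in /w exprMn -rmorphXn -!exprM.
  by rewrite mulnC [(z * c)%N]mulnC.
rewrite -(big_mkord xpredT (fun i => w ^+ i)) Zp_cast // big_mkord.
have conjK j : zeta R (m k) ^+ j * (zeta R (m k) ^+ j)^*%C = 1.
  by rewrite zetaX expi_conj.
have [ac|ac] := eqVneq a c.
  rewrite (eq_bigr (fun=> 1)) => [|i _]; last by rewrite /w ac conjK expr1n.
  by rewrite sumr_const card_ord mulVf // gt_eqF.
rewrite sum_unity_root ?mulr0 //.
  rewrite /w exprMn -rmorphXn exprAC (prim_expr_order prim) expr1n mul1r.
  by rewrite exprAC (prim_expr_order prim) expr1n rmorph1.
apply: contra ac => /eqP w1.
have : zeta R (m k) ^+ a == zeta R (m k) ^+ c.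
  rewrite -[X in X == _]mulr1 -(conjK c) [_ ^+ c * _]mulrC mulrA -/w w1 mul1r.
  by [].
by rewrite (eq_prim_root_expr prim) !modn_small.
Qed.

Lemma cexp_psi N i j x : (i < M N)%N -> (j < M N)%N ->
  cexp (iota 0 N) (fun u => psi R i u * (psi R j u)^*%C) x = (i == j)%:R.
Proof.
elim: N i j x => [|N IH] i j x.
  by rewrite /= !ltnS !leqn0 => /eqP-> /eqP->; rewrite /psi !big_ord0 rmorph1 mulr1.
move=> iM jM; have MN : (0 < M N)%N by apply: gen_num_gt0.
have split_psi i0 u : (i0 < M N.+1)%N -> psi R i0 u =
    psi R (i0 %% M N) u * rademacher R N u ^+ (i0 %/ M N).
  move=> i0M; rewrite {1}(divn_eq i0 (M N)) addnC [(_ %/ _ * _)%N]mulnC.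
  by rewrite psiD ?ltn_mod // psiM_top // ltn_divLR.
rewrite -addn1 iotaD cexp_cat /= add0n.
rewrite (@eq_cexp _ _ (iota 0 N) _ (fun u => ((i %/ M N)%N == (j %/ M N)%N)%:R *
  (psi R (i %% M N) u * (psi R (j %% M N) u)^*%C))); last first.
  move=> u; rewrite -(@avg_rademacher N _ _ u); last 2 first.
  - by rewrite ltn_divLR.
  - by rewrite ltn_divLR.
  rewrite mulrC -(@avg_pull _ _ N _
    (fun v => psi R (i %% M N) v * (psi R (j %% M N) v)^*%C)); last first.
    apply: (level_free (leqnn N)).
    apply: (level_comp2 (fun v w : C => v * w^*%C)).
      by apply: level_psi => //; rewrite ltn_mod.
    by apply: level_psi => //; rewrite ltn_mod.
  congr (avg _ _ _); apply/funext => v.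
  by rewrite (split_psi i v iM) (split_psi j v jM) rmorphM /=; ring.
rewrite cexpZ IH ?ltn_mod // -natrM mulnb; congr (nat_of_bool _)%:R.
apply/andP/eqP => [[/eqP q /eqP r]|->]; last by rewrite !eqxx.
by rewrite (divn_eq i (M N)) q r -divn_eq.
Qed.

End Orthonormality.

Section FourierBridge.
Local Open Scope classical_set_scope.
Variables (R : realType) (m : nat -> nat).
Hypothesis m_ge2 : forall k, (2 <= m k)%N.
Local Notation C := R[i].
Local Notation G := (vilenkin m).
Local Notation M := (gen_num m).
Variable mu : probability G R.
Hypothesis mu_haar : haar mu.
Implicit Types (x y t u : G).

Lemma ReMnat (n : nat) (z : C) : complex.Re (n%:R^-1 * z) = n%:R^-1 * complex.Re z.
Proof.
have -> : n%:R^-1 = (n%:R^-1 : R)%:C%C :> C by rewrite fmorphV rmorph_nat.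
by case: z => a b; simpc.
Qed.

Lemma ImMnat (n : nat) (z : C) : complex.Im (n%:R^-1 * z) = n%:R^-1 * complex.Im z.
Proof.
have -> : n%:R^-1 = (n%:R^-1 : R)%:C%C :> C by rewrite fmorphV rmorph_nat.
by case: z => a b; simpc.
Qed.

Lemma cexp_Re s (g : G -> C) x :
  complex.Re (cexp s g x) = cexp s (fun y => complex.Re (g y)) x.
Proof.
elim: s x => //= k s IH x; rewrite /avg ReMnat; congr (_ * _).
rewrite (raddf_sum (@complex.Re R : Rcomplex R -> R)).
by apply: eq_bigr => z _; exact: IH.
Qed.

Lemma cexp_Im s (g : G -> C) x :
  complex.Im (cexp s g x) = cexp s (fun y => complex.Im (g y)) x.
Proof.
elim: s x => //= k s IH x; rewrite /avg ImMnat; congr (_ * _).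
rewrite (raddf_sum (@complex.Im R : Rcomplex R -> R)).
by apply: eq_bigr => z _; exact: IH.
Qed.

Lemma level_cintegral n (g : G -> C) x : level n g ->
  cintegral mu setT g = cexp (iota 0 n) g x.
Proof.
move=> lg; apply/eqP; rewrite eq_complex /= cexp_Re cexp_Im /Rintegral.
rewrite (level_integral m_ge2 mu_haar x (level_comp (@complex.Re R) lg)).
by rewrite (level_integral m_ge2 mu_haar x (level_comp (@complex.Im R) lg)) !eqxx.
Qed.

Lemma level_cintegral_cylinder k n (g : G -> C) x y : (k <= n)%N -> level n g ->
  cintegral mu (cylinder k x) g =
  cexp (iota 0 n) (fun u => (agree k u x)%:R * g u) y.
Proof.
move=> kn lg.
have restrictE (h : C -> R) : (forall (b : bool) z, h (b%:R * z) = b%:R * h z) ->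
    (\int[mu]_(u in cylinder k x) (h (g u))%:E =
     \int[mu]_u (h ((agree k u x)%:R * g u))%:E)%E.
  move=> hM; rewrite integral_mkcond; apply: eq_integral => u _.
  rewrite /patch cylinderE; case: ifPn => [|].
    by rewrite inE /= => ->; rewrite hM mul1r.
  by rewrite notin_setE /= => /negP/negbTE ->; rewrite hM mul0r.
rewrite -level_cintegral; last first.
  apply: (level_comp2 (fun v w : C => v * w)) lg.
  apply: (level_le kn).
  exact: (level_comp (fun b : bool => b%:R : C) (@level_agree m k x)).
rewrite /cintegral /Rintegral !restrictE //.
  by move=> b [z1 z2]; case: b; rewrite ?mul1r ?mul0r.
by move=> b [z1 z2]; case: b; rewrite ?mul1r ?mul0r.
Qed.

Variable f : nat -> G -> C.
Hypothesis mf : martingale mu f.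

Lemma martingale_level k : level k (f k).
Proof. exact/level_level_measurable/(mart_adapted mf). Qed.

(** Tested on the cylinder of level [k] around [x], both sides of the martingale identity are a
    constant times the same positive measure, which cancels. *)
Lemma martingale_avg k x : avg k (f k.+1) x = f k x.
Proof.
have : <<s level_cylinders m k >> (cylinder k x).
  by apply: sub_sigma_algebra; exists x.
move=> /(mart_cond mf).
rewrite (level_cintegral_cylinder x x (leqnSn k) (@martingale_level k.+1)).
rewrite (level_cintegral_cylinder x x (leqnn k) (@martingale_level k)).
have lk : level k (fun u => (agree k u x)%:R : C).
  exact: (level_comp (fun b : bool => b%:R : C) (@level_agree m k x)).
rewrite -{1}addn1 iotaD cexp_cat /= add0n.
rewrite (@eq_cexp _ _ (iota 0 k) _ (fun u => avg k (f k.+1) x * (agree k u x)%:R)); last first.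
  move=> u; rewrite avg_pull; last exact: level_free lk.
  case: (boolP (agree k u x)) => [/agreeP ux|_]; last by rewrite mul0r mulr0.
  rewrite mul1r mulr1; apply: level_avgS ux; exact: martingale_level.
have -> : cexp (iota 0 k) (fun u => (agree k u x)%:R * f k u) x =
    cexp (iota 0 k) (fun u => f k x * (agree k u x)%:R) x.
  apply: eq_cexp_in => u _; rewrite mulrC.
  case: (boolP (agree k u x)) => [/agreeP ux|_]; last by rewrite !mulr0.
  by rewrite !mulr1; exact: martingale_level.
rewrite !cexpZ; apply: mulIf.
by rewrite (cexp_agree _ m_ge2) // invr_eq0 gt_eqF // gen_numR_gt0.
Qed.

Lemma cexp_martingale N d x : cexp (iota N d) (f (N + d)) x = f N x.
Proof.
elim: d x => [|d IH] x; first by rewrite addn0.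
rewrite -{1}addn1 iotaD cexp_cat -[RHS]IH; congr (cexp _ _ _).
by apply/funext => y /=; rewrite addnS martingale_avg.
Qed.

(** For [k >= N] the character has level [N] and [f k] averages back to [f N], so the sequence
    defining the limit is eventually constant. *)
Lemma mart_fcoefE N i x : (i < M N)%N ->
  mart_fcoef mu f i = cexp (iota 0 N) (fun u => f N u * (psi R i u)^*%C) x.
Proof.
move=> iN; apply: (@norm_lim_near_cst C C^o).
exists N => // k /= Nk.
have lpsi K : (N <= K)%N -> level K (fun u => (psi R i u)^*%C : C).
  move=> NK; apply: (level_comp (fun z : C => z^*%C)); apply: level_psi => //.
  exact: leq_trans iN (leq_gen_num m_ge2 NK).
rewrite /fcoef (@level_cintegral k _ x); last first.
  by apply: (level_comp2 (fun v w : C => v * w)) (lpsi k Nk); exact: martingale_level.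
rewrite (cexp_split _ _ Nk) add0n; congr (cexp _ _ _); apply/funext => u.
rewrite (eq_cexp _ (H := fun v => (psi R i v)^*%C * f k v)); last by move=> v; rewrite mulrC.
rewrite cexp_pull_level; last exact: lpsi.
by rewrite -[X in f X](subnKC Nk) cexp_martingale mulrC.
Qed.

Lemma partial_sum_fcoefE N k x x0 : (k <= M N)%N ->
  partial_sum (mart_fcoef mu f) k x =
  cexp (iota 0 N) (fun u => f N u * dirichlet R k (x - u)) x0.
Proof.
move=> kN; rewrite /partial_sum /dirichlet.
rewrite (eq_cexp _ (H := fun u => \sum_(i < k) psi R i x * (f N u * (psi R i u)^*%C))).
  rewrite cexp_sum; apply: eq_bigr => i _.
  by rewrite cexpZ mulrC (@mart_fcoefE N i x0) // (leq_trans _ kN).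
by move=> u; rewrite mulr_sumr; apply: eq_bigr => i _; rewrite psiB // mulrCA.
Qed.

Lemma level_partial_sum (c : nat -> C) N k : (k <= M N)%N ->
  level N (partial_sum c k : G -> C).
Proof.
move=> kN; apply: level_sum => i _; apply: (level_comp (fun z => c i * z)).
by apply: level_psi => //; exact: leq_trans kN.
Qed.

Lemma fcoef_partial_sum (c : nat -> C) k i :
  fcoef mu (partial_sum c k) i = (if (i < k)%N then c i else 0).
Proof.
pose N := maxn i k.
have kN : (k <= M N)%N.
  by apply: leq_trans (leq_maxr i k) _; exact/ltnW/ltn_gen_num.
have iN : (i < M N)%N by apply: leq_ltn_trans (leq_maxl i k) _; exact: ltn_gen_num.
rewrite /fcoef (@level_cintegral N _ 0); last first.
  apply: (level_comp2 (fun v w : C => v * w^*%C)); first exact: level_partial_sum.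
  exact: level_psi.
rewrite (eq_cexp _ (H := fun u => \sum_(j < k) c j * (psi R j u * (psi R i u)^*%C))).
  rewrite cexp_sum (eq_bigr (fun j : 'I_k => if (j : nat) == i then c j else 0)).
    rewrite -big_mkcond /=; case: ifPn => ik.
      by rewrite (big_pred1 (Ordinal ik)).
    by rewrite big_pred0 // => j; apply: contraNF ik => /eqP <-.
  move=> j _; rewrite cexpZ cexp_psi //; last exact: leq_trans kN.
  by case: eqP; rewrite ?mulr1 ?mulr0.
by move=> u; rewrite mulr_suml; apply: eq_bigr => j _; rewrite mulrA.
Qed.

Lemma fcoef_sum (I : Type) (s : seq I) (a : I -> C) (g : I -> G -> C) N i :
  (forall j, level N (g j)) ->
  fcoef mu (fun x => \sum_(j <- s) a j * g j x) i = \sum_(j <- s) a j * fcoef mu (g j) i.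
Proof.
move=> lg; pose K := maxn i N.
have lK (h : G -> C) : level N h -> level K (fun u => h u * (psi R i u)^*%C).
  move=> lh; apply: (level_comp2 (fun v w : C => v * w^*%C)).
    exact: level_le (leq_maxr i N) lh.
  by apply: level_psi => //; apply: leq_ltn_trans (leq_maxl i N) _; exact: ltn_gen_num.
rewrite /fcoef (@level_cintegral K _ 0); last first.
  apply: lK; apply: level_sum => j _; exact: (level_comp (fun z => a j * z) (lg j)).
rewrite (eq_cexp _ (H := fun u => \sum_(j <- s) a j * (g j u * (psi R i u)^*%C))).
  rewrite cexp_sum; apply: eq_bigr => j _.
  by rewrite cexpZ; congr (_ * _); rewrite (@level_cintegral K _ 0 (lK _ (lg j))).
by move=> u; rewrite mulr_suml; apply: eq_bigr => j _; rewrite mulrA.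
Qed.

Lemma fun_mart_rieszE n K x : fun_mart mu (riesz_mean mu f n) K x =
  ((riesz_log R n)^-1)%:C%C * \sum_(1 <= k < n.+1)
    k%:R^-1 * partial_sum (mart_fcoef mu f) (minn k (M K)) x.
Proof.
set c := mart_fcoef mu f; rewrite /fun_mart /partial_sum.
pose a k : C := ((riesz_log R n)^-1)%:C%C / k%:R.
have coefE i : fcoef mu (riesz_mean mu f n) i =
    \sum_(1 <= k < n.+1) a k * (if (i < k)%N then c i else 0).
  (* In the range of summation [minn k n] is [k]; this form gives every member of the family level
     [n], as the linearity lemma requires. *)
  transitivity (fcoef mu (fun y => \sum_(k <- index_iota 1 n.+1)
      a k * partial_sum c (minn k n) y) i).
    congr (fcoef _ _ _); apply/funext => y; rewrite /riesz_mean mulr_sumr.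
    rewrite !big_nat; apply: eq_bigr => k /andP[_ kn].
    by rewrite (minn_idPl _) // /a [_ / k%:R]mulrC mulrA.
  rewrite (@fcoef_sum _ _ _ _ n) => [|k]; last first.
    apply: level_partial_sum; rewrite (leq_trans (geq_minr _ _)) //.
    exact/ltnW/ltn_gen_num.
  rewrite !big_nat; apply: eq_bigr => k /andP[_ kn].
  by rewrite fcoef_partial_sum (minn_idPl _).
under eq_bigr do rewrite coefE mulr_suml.
rewrite exchange_big /= mulr_sumr; apply: eq_bigr => k _.
rewrite mulrA -/(a k) -/(partial_sum c (minn k (M K)) x).
have -> : \sum_(i < M K) a k * (if (i < k)%N then c i else 0) * psi R i x =
    \sum_(i < M K | (i < k)%N) a k * (c i * psi R i x).
  rewrite [RHS]big_mkcond; apply: eq_bigr => i _.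
  by case: ifP => _; rewrite ?mulr0 ?mul0r ?mulrA.
rewrite -mulr_sumr; congr (_ * _); rewrite /partial_sum.
rewrite -(big_mkord (fun i => (i < k)%N) (fun i => c i * psi R i x)).
rewrite -(big_mkord xpredT (fun i => c i * psi R i x)).
rewrite [in RHS](@big_nat_widen _ _ _ _ _ (M K)) ?geq_minr //.
rewrite [LHS]big_nat_cond [RHS]big_nat_cond; apply: eq_bigl => i /=; rewrite leq_min.
by case: (i < M K)%N; rewrite ?andbT ?andbF.
Qed.

Lemma normc_fun_mart_riesz n N K x x0 : (n <= M N)%N ->
  Normc.normc (fun_mart mu (riesz_mean mu f n) K x) = (riesz_log R n)^-1 *
  Normc.normc (cexp (iota 0 N) (fun u => f N u * riesz_kernel R n (M K) (x - u)) x0).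
Proof.
move=> nN; rewrite fun_mart_rieszE Normc.normcM; congr (_ * _).
  by rewrite /= expr0n /= addr0 sqrtr_sqr ger0_norm // invr_ge0 riesz_log_ge0.
congr Normc.normc; rewrite cexp_riesz_kernel.
rewrite big_ord_recl /= invr0 mul0r add0r big_add1 /= big_mkord.
apply: eq_bigr => k _; congr (_ * _); apply: partial_sum_fcoefE.
rewrite (leq_trans (geq_minl _ _)) // (leq_trans _ nN) //.
Qed.

Lemma level_fun_mart_riesz n N K : (n <= M N)%N ->
  level N (fun_mart mu (riesz_mean mu f n) K).
Proof.
move=> nN x y xy; rewrite !fun_mart_rieszE; congr (_ * _).
rewrite !big_nat; apply: eq_bigr => k /andP[_ kn]; congr (_ * _).
apply: level_partial_sum xy; rewrite (leq_trans (geq_minl _ _)) //.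
exact: leq_trans nN.
Qed.

End FourierBridge.

(** * Hardy norms *)

Section HardyNorm.
Local Open Scope classical_set_scope.
Variables (R : realType) (m : nat -> nat).
Hypothesis m_ge2 : forall k, (2 <= m k)%N.
Local Notation C := R[i].
Local Notation G := (vilenkin m).
Variable mu : probability G R.
Hypothesis mu_haar : haar mu.
Variable p : R.
Hypothesis p_gt0 : 0 < p.
Implicit Types (f : nat -> G -> C) (x : G).

Lemma hardy_norm_powR f :
  (hardy_norm mu p f `^ p = \int[mu]_x (`|maximal f x| `^ p))%E.
Proof. by rewrite /hardy_norm poweR_Lnorm // gt_eqF. Qed.

Lemma maximal_ge f k x : ((Normc.normc (f k x))%:E <= maximal f x)%E.
Proof. by apply: ereal_sup_ubound; exists k. Qed.

Lemma maximal_ge0 f x : (0 <= maximal f x)%E.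
Proof. by apply: le_trans (maximal_ge f 0 x); rewrite lee_fin normc_ge0. Qed.

Lemma poweR_mono (x y : \bar R) : (0 <= x)%E -> (x <= y)%E -> (x `^ p <= y `^ p)%E.
Proof.
move=> x0 xy; apply: gt0_ler_poweR; rewrite ?in_itv /= ?leey ?andbT ?(ltW p_gt0) //.
exact: le_trans xy.
Qed.

Lemma measurable_maximal f : (forall k, level k (f k)) ->
  measurable_fun setT (maximal f).
Proof.
move=> lf; pose u k x := (Normc.normc (f k x))%:E.
have -> : maximal f = fun x => esups (u ^~ x) 0%N.
  apply/funext => x; congr ereal_sup.
  by apply/seteqP; split => y [k _ <-]; exists k.
apply: measurable_fun_esups => k; apply/measurable_EFinP.
exact: level_measurable_fun (level_comp (@Normc.normc R) (lf k)).
Qed.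

Lemma cexp_partial_max_le f N x0 : (forall k, level k (f k)) ->
  ((cexp (iota 0 N) (fun x => partial_max f N x `^ p) x0)%:E <=
    hardy_norm mu p f `^ p)%E.
Proof.
move=> lf.
have lN : level N (fun x => partial_max f N x `^ p).
  move=> x y xy; congr (_ `^ _); apply: eq_bigr => k _; congr Normc.normc.
  by apply: lf => j jk; apply: xy; rewrite (leq_trans jk) // -ltnS.
rewrite -(level_integral m_ge2 mu_haar x0 lN) hardy_norm_powR.
apply: ge0_le_integral => //.
- by move=> x _; rewrite lee_fin powR_ge0.
- by apply/measurable_EFinP; exact: level_measurable_fun lN.
- apply: (measurableT_comp (measurable_poweR p)).
  by apply: measurableT_comp => //; exact: measurable_maximal.
move=> x _; rewrite -poweR_EFin gee0_abs ?maximal_ge0 //.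
apply: poweR_mono; first by rewrite lee_fin partial_max_ge0.
rewrite /partial_max; have [k _ ->] := @eq_bigmax _ R _ 0 (ord0 : 'I_N.+1) xpredT
  (fun k : 'I_N.+1 => Normc.normc (f k x)) isT (fun k _ => normc_ge0 _).
exact: maximal_ge.
Qed.

Lemma hardy_norm_riesz_le b f n N x0 : (forall k, (m k <= b)%N) -> 2 * p < 1 ->
  martingale mu f -> (0 < n <= N)%N ->
  ((ln n%:R `^ p)%:E * hardy_norm mu p (fun_mart mu (riesz_mean mu f n)) `^ p <=
    (cexp (iota 0 N) (majorant b p f N n x0) x0)%:E)%E.
Proof.
move=> m_le p_lt mf /andP[n0 nN].
have lf := martingale_level mf; have af := martingale_avg m_ge2 mu_haar mf.
have nMN : (n <= gen_num m N)%N by apply: leq_trans nN _; exact/ltnW/ltn_gen_num.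
have Y0 x : 0 <= majorant b p f N n x0 x by exact: majorant_ge0.
(* For [n = 1] the weight is [0 ^ p = 0]; for larger [n], [ln n > 0] also yields [l_n > 0]. *)
have [n1|n2] := leqP n 1.
  have -> : n = 1%N by apply/eqP; rewrite eqn_leq n1.
  rewrite ln1 powR0 ?gt_eqF // mul0e lee_fin.
  by apply: cexp_ge0 => // x; exact: majorant_ge0.
have ln0 : 0 < ln n%:R :> R by rewrite ln_gt0 // ltr1n.
have l0 : 0 < riesz_log R n.
  apply: lt_le_trans ln0 _; apply: le_trans _ (ln_le_riesz_log R n).
  by rewrite ler_ln ?posrE ?ltr0n // ler_nat.
have lmax : level N (maximal (fun_mart mu (riesz_mean mu f n))).
  move=> x y xy; rewrite /maximal.
  by under eq_fun do rewrite (level_fun_mart_riesz m_ge2 mu_haar _ _ nMN xy).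
have lmaj : level N (majorant b p f N n x0) by exact: level_majorant.
have mmax : measurable_fun [set: G]
    (fun x => `|maximal (fun_mart mu (riesz_mean mu f n)) x| `^ p)%E.
  apply: (measurableT_comp (measurable_poweR p)).
  by apply: measurableT_comp => //; exact: level_measurable_fun lmax.
rewrite -(level_integral m_ge2 mu_haar x0 lmaj) hardy_norm_powR.
rewrite -ge0_integralZl_EFin ?powR_ge0 //; last by move=> x _; exact: poweR_ge0.
apply: ge0_le_integral => //.
- by move=> x _; rewrite mule_ge0 ?lee_fin ?powR_ge0 ?poweR_ge0.
- exact: measurable_funeM.
- by apply/measurable_EFinP; exact: level_measurable_fun lmaj.
move=> x _; rewrite gee0_abs ?maximal_ge0 //.
(* The [1 / l_n] of the Riesz mean stays outside the majorant; after the power p it meets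
   [ln n ^ p], and [ln n / l_n <= 1]. *)
pose B := (riesz_log R n)^-1 * majorant b p f N n x0 x `^ p^-1.
have B0 : 0 <= B by rewrite mulr_ge0 ?powR_ge0 // invr_ge0 ltW.
have maxB : (maximal (fun_mart mu (riesz_mean mu f n)) x <= B%:E)%E.
  apply: ub_ereal_sup => _ [K _ <-]; rewrite lee_fin.
  rewrite (normc_fun_mart_riesz m_ge2 mu_haar mf K x x0 nMN).
  rewrite ler_wpM2l ?invr_ge0 ?(ltW l0) //.
  set z := Normc.normc _; have z0 : 0 <= z by exact: normc_ge0.
  have -> : z = (z `^ p) `^ p^-1 by rewrite -powRrM divff ?gt_eqF // powRr1.
  apply: ge0_ler_powR; rewrite ?nnegrE ?invr_ge0 ?(ltW p_gt0) ?powR_ge0 //.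
  exact: powR_le_majorant.
apply: (@le_trans _ _ ((ln n%:R `^ p)%:E * (B%:E `^ p))%E).
  by rewrite lee_wpmul2l ?lee_fin ?powR_ge0 // poweR_mono // maximal_ge0.
rewrite poweR_EFin -EFinM lee_fin /B powRM ?powR_ge0 ?invr_ge0 ?(ltW l0) //.
rewrite -powRrM mulVf ?gt_eqF // powRr1 // mulrA -powRM ?invr_ge0 ?(ltW l0) ?(ltW ln0) //.
rewrite ler_piMl //; apply: (@le_trans _ _ (1 `^ p)); last by rewrite powR1.
apply: ge0_ler_powR; rewrite ?nnegrE ?(ltW p_gt0) ?divr_ge0 ?(ltW l0) ?(ltW ln0) //.
rewrite ler_pdivrMr // mul1r; apply: le_trans _ (ln_le_riesz_log R n).
by rewrite ler_ln ?posrE ?ltr0n // ler_nat.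
Qed.

End HardyNorm.

Theorem theorem1 (R : realType) (m : nat -> nat)
  (m_ge2 : forall k, (2 <= m k)%N)
  (m_bounded : exists b : nat, forall k, (m k <= b)%N)
  (mu : probability (vilenkin m) R) (mu_haar : haar mu)
  (p : R) (p_gt0 : 0 < p) (p_lt : p < 1 / 2) :
  exists c : R, forall f : nat -> vilenkin m -> R[i], hardy mu p f ->
    (\sum_(1 <= n <oo)
        (ln n%:R `^ p)%:E * hardy_norm mu p (fun_mart mu (riesz_mean mu f n)) `^ p
        * ((n%:R `^ (2 - 2 * p))^-1)%:E
      <= c%:E * hardy_norm mu p f `^ p)%E.
Proof.
have [b m_le] := m_bounded.
have p2 : 2 * p < 1 by rewrite mulrC -ltr_pdivlMr.
exists (main_const b p) => f [mf _].
have lf := martingale_level mf; have af := martingale_avg m_ge2 mu_haar mf.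
have term_ge0 n : (0 <= (ln n%:R `^ p)%:E *
    hardy_norm mu p (fun_mart mu (riesz_mean mu f n)) `^ p *
    ((n%:R `^ (2 - 2 * p))^-1)%:E)%E.
  by rewrite !mule_ge0 ?lee_fin ?invr_ge0 ?powR_ge0 ?poweR_ge0.
apply: lime_le; first by apply: is_cvg_nneseries => n _ _; exact: term_ge0.
(* The truncation index of the series also serves as the level of all averages, since every [n < N]
   satisfies [n <= N]. The constant does not depend on it. *)
apply: nearW => N; pose x0 : vilenkin m := 0.
apply: (@le_trans _ _ (\sum_(1 <= n < N) ((n%:R `^ (2 - 2 * p))^-1 *
    cexp (iota 0 N) (majorant b p f N n x0) x0))%:E).
  rewrite -sumEFin !big_nat; apply: lee_sum => n /andP[n1 nN].
  rewrite EFinM muleC lee_wpmul2l ?lee_fin ?invr_ge0 ?powR_ge0 //.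
  by apply: hardy_norm_riesz_le => //; rewrite n1 ltnW.
have c0 : 0 <= main_const b p.
  have wc0 : 0 <= weight_const b p.
    have := @weighted_series_le R b p p_gt0 p2 1 0 isT.
    by rewrite big_geq.
  apply: mulr_ge0; first by apply: mulr_ge0 => //; exact: powR_ge0.
  apply: mulr_ge0 => //; rewrite invr_ge0 subr_ge0 ltW //.
  by have /andP[] : 0 <= (2 : R) `^ (- p) < 1 by apply: powR2_lt1; rewrite oppr_lt0.
apply: (@le_trans _ _ (main_const b p *
    cexp (iota 0 N) (fun x => partial_max f N x `^ p) x0)%:E).
  by rewrite lee_fin sum_majorant_le.
by rewrite EFinM lee_wpmul2l ?lee_fin // cexp_partial_max_le.
Qed.
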